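(* Let $D\subset\mathbb{R}^d$ be a bounded domain with smooth boundary $\partial D$, let $\Lambda,\beta>0$ and $\kappa\neq0$, and let $G:\mathbb{R}_+\to\mathbb{R}_+$ be locally Lipschitz with $G(0)=0$, $z\mapsto G(z)/z$ increasing on $(0,\infty)$, and $G(z)\le\Lambda z^{1+\beta}$ for all $z>0$. Let $\{W_t,\ t\ge0\}$ be a standard one-dimensional Brownian motion, let $f:D\to\mathbb{R}_+$ be of class $C^2$ and not identically zero, and let $\{S_t,\ t\ge0\}$ be the semigroup of the Dirichlet Laplacian on $D$. Consider (pathwise) the equation $$\frac{\partial v}{\partial t}(t,x)=\Delta v(t,x)-\frac{\kappa^2}{2}v(t,x)+e^{-\kappa W_t}G\big(e^{\kappa W_t}v(t,x)\big),\ t>0,\ x\in D;\qquad v(0,x)=f(x)\ (x\in D);\qquad v(t,x)=0\ (x\in\partial D).$$ For every path of $W$ for which $$\Lambda\beta\int_0^\infty e^{\kappa\beta W_r}\big\|e^{-\kappa^2r/2}S_rf\big\|_\infty^\beta\,dr<1,$$ this equation admits a global solution $v(t,x)$ (defined for all $t\ge0$, $x\in D$) that satisfies $$0\le v(t,x)\le\frac{e^{-\kappa^2t/2}S_tf(x)}{\Big(1-\Lambda\beta\int_0^te^{\kappa\beta W_r}\|e^{-\kappa^2r/2}S_rf\|_\infty^\beta\,dr\Big)^{1/\beta}},\qquad t\ge0,\ x\in D.$$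
   Context: The semigroup $\{S_t\}$ is that of $d$-dimensional Brownian motion killed at $\partial D$, normalized so that its generator is $\Delta$ with Dirichlet boundary condition. $\|\cdot\|_\infty$ is the sup norm on $D$. The random partial differential equation is understood trajectorywise, for fixed paths of $W$, and is rewritten in the mild form $$v(t,x)=e^{-\kappa^2t/2}S_tf(x)+\int_0^te^{-\kappa^2(t-r)/2}S_{t-r}\Big(e^{-\kappa W_r}G\big(e^{\kappa W_r}v(r,\cdot)\big)\Big)(x)\,dr;$$ a global solution is a function $v$ satisfying this identity with finite values for all $t\ge0$ and $x\in D$. *)

(* Defs.v *)
From HB Require Import structures.
From mathcomp Require Import all_boot all_order all_algebra.
From mathcomp Require Import all_classical all_reals all_analysis.
Set Implicit Arguments.
Unset Strict Implicit.
Unset Printing Implicit Defensive.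
Import Order.TTheory GRing.Theory Num.Theory.
Import numFieldNormedType.Exports.
Local Open Scope classical_set_scope.
Local Open Scope ring_scope.

(** * Smooth functions and bounded smooth domains of R^d *)

(* [A] is meant to be open. *)
Fixpoint class_C (R : realType) (d k : nat) (A : set 'rV[R]_d)
    (f : 'rV[R]_d -> R) : Prop :=
  {in A, continuous f} /\
  match k with
  | 0%N => True
  | k'.+1 => forall i : 'I_d,
      (forall x, A x -> derivable f x (delta_mx 0 i)) /\
      class_C k' A (fun x => 'D_(delta_mx 0 i) f x)
  end.

Definition frontier (T : topologicalType) (A : set T) : set T :=
  closure A `\` A°.

(* Near each frontier point, [D] is a sublevel set of a smooth submersion. *)
Definition smooth_frontier (R : realType) (d : nat) (D : set 'rV[R]_d) : Prop :=
  forall p, frontier D p ->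
  exists (U : set 'rV[R]_d) (phi : 'rV[R]_d -> R),
    [/\ open U /\ U p,
        forall k, class_C k U phi,
        forall x, U x -> exists i : 'I_d, 'D_(delta_mx 0 i) phi x != 0 &
        U `&` D = U `&` [set x | phi x < 0]
        /\ U `&` frontier D = U `&` [set x | phi x = 0]].

Definition bounded_smooth_domain (R : realType) (d : nat) (D : set 'rV[R]_d)
    : Prop :=
  [/\ open D, connected D, D !=set0, bounded_set D & smooth_frontier D].

(** * Brownian motion *)

(* Processes are indexed by [R] but only the times [t >= 0] matter. *)
Record brownian_motion (R : realType) (disp : measure_display)
    (T : measurableType disp) (P : probability T R) (W : R -> T -> R) : Prop :=
  BrownianMotion {
    bm_measurable : forall t : R, 0 <= t -> measurable_fun [set: T] (W t) ;
    bm_start : forall w, W 0 w = 0 ;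
    bm_continuous : forall w, {within `[0, +oo[, continuous (fun t => W t w)} ;
    bm_gaussian : forall s t : R, 0 <= s -> s < t -> forall A, measurable A ->
      P [set w | A (W t w - W s w)] = normal_prob 0 (Num.sqrt (t - s)) A ;
    bm_independent : forall (n : nat) (t : nat -> R) (A : nat -> set R),
      0 <= t 0%N -> (forall k, t k <= t k.+1) ->
      (forall k, measurable (A k)) ->
      P (\bigcap_(k < n) [set w | A k (W (t k.+1) w - W (t k) w)]) =
      (\prod_(k < n) P [set w | A k (W (t k.+1) w - W (t k) w)%R])%E
  }.

(* The second clause is independence of the [d] coordinate processes, stated
   on cylinder sets. *)
Definition brownian_motion_rV (R : realType) (d : nat) (disp : measure_display)
    (T : measurableType disp) (P : probability T R)
    (B : R -> T -> 'rV[R]_d) : Prop :=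
  (forall i : 'I_d, brownian_motion P (fun t w => B t w 0 i)) /\
  (forall (n : nat) (t : nat -> R) (A : 'I_d -> nat -> set R),
    (forall k, 0 <= t k) -> (forall i k, measurable (A i k)) ->
    P (\bigcap_(i in [set: 'I_d]) \bigcap_(k < n) [set w | A i k (B (t k) w 0 i)])
    = (\prod_(i < d) P (\bigcap_(k < n) [set w | A i k (B (t k) w 0%R i)]))%E).

(** * Semigroup of Brownian motion killed on leaving [D] *)

Section killed_semigroup.
Context (R : realType) (d : nat) (disp : measure_display)
  (T : measurableType disp) (P : probability T R)
  (B : R -> T -> 'rV[R]_d) (D : set 'rV[R]_d).

(* A standard Brownian motion has generator Delta/2; the factor sqrt 2 turns
   it into Delta. *)
Definition path_from (x : 'rV[R]_d) (t : R) (w : T) : 'rV[R]_d :=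
  x + Num.sqrt 2 *: B t w.

Definition exit_time (x : 'rV[R]_d) (w : T) : \bar R :=
  ereal_inf [set s%:E | s in [set s : R | 0 <= s /\ ~ D (path_from x s w)]].

(* On the domain of integration the path is still in [D], so only the values
   of [g] on [D] are used; for [g >= 0] the result may be [+oo]. *)
Definition killed_semigroup (t : R) (g : 'rV[R]_d -> R) (x : 'rV[R]_d)
    : \bar R :=
  (\int[P]_(w in [set w | t%:E < exit_time x w]) (g (path_from x t w))%:E)%E.

End killed_semigroup.

(** * The random partial differential equation in mild form *)

Definition sup_norm (R : realType) (T : Type) (D : set T) (g : T -> \bar R)
    : \bar R :=
  ereal_sup [set `|g x|%E | x in D].

(* Borel sigma-algebra of R x R^d. *)
Definition borel_time_space (R : realType) (d : nat) :=
  g_sigma_algebraType (@open (R * 'rV[R]_d)%type).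

Section mild_equation.
Context (R : realType) (d : nat) (D : set 'rV[R]_d)
  (S : R -> ('rV[R]_d -> R) -> 'rV[R]_d -> \bar R)
  (kappa beta : R) (G : R -> R) (W : R -> R) (f : 'rV[R]_d -> R).

Definition damped (t : R) (x : 'rV[R]_d) : \bar R :=
  ((expR (- (kappa ^+ 2 * t / 2)))%:E * S t f x)%E.

Definition weighted_integral (I : set R) : \bar R :=
  (\int[lebesgue_measure]_(r in I)
     ((expR (kappa * beta * W r))%:E * sup_norm D (damped r) `^ beta))%E.

(* Nonnegativity is what lets [G], a function on [0, +oo[, be applied, and
   joint measurability is what makes the integrals meaningful. *)
Definition global_mild_solution (v : R -> 'rV[R]_d -> R) : Prop :=
  [/\ forall (t : R) x, 0 <= t -> D x -> 0 <= v t x,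
      measurable_fun
        ([set p | 0 <= p.1 /\ D p.2] : set (borel_time_space R d))
        (fun p : borel_time_space R d => v p.1 p.2) &
      forall (t : R) x, 0 <= t -> D x ->
        ((v t x)%:E = damped t x +
          \int[lebesgue_measure]_(r in `[0%R, t])
            ((expR (- (kappa ^+ 2 * (t - r) / 2)))%:E *
             S (t - r)%R
               (fun y => expR (- (kappa * W r)) * G (expR (kappa * W r) * v r y))%R
               x))%E].

End mild_equation.

(* Main.v *)
Require Import Defs.
From HB Require Import structures.
From mathcomp Require Import all_boot all_order all_algebra.
From mathcomp Require Import all_classical all_reals all_analysis.
From mathcomp Require Import measurable_realfun.
From mathcomp Require Import ring lra.
Set Implicit Arguments.
Unset Strict Implicit.
Unset Printing Implicit Defensive.
Import Order.TTheory GRing.Theory Num.Theory.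
Import numFieldNormedType.Exports.
Local Open Scope classical_set_scope.
Local Open Scope ring_scope.

(** Write [damped t x] for e^{-kappa^2 t/2} S_t f(x), [M r] for its sup norm
    over [D], [H t] for the integral over [0, t] of weight r = e^{kappa beta
    W_r} (M r)^beta, and [A t] = (1 - Lambda beta H(t))^{-1/beta}.

    The mild equation is the fixed point equation of a monotone map
    [mild_map], since [G] is nondecreasing. Picard iteration from 0 therefore
    increases, and all that has to be seen is that it stays below [A t *
    damped t x]: it then converges to a finite function, and monotone
    convergence, with the continuity of [G], turns the limit into a fixed
    point satisfying the announced bound.

    The domination propagates for the following reason ([mild_map_le]). If v
    <= A * damped, then G(z) <= Lambda z^{1+beta} bounds the source e^{-kappa
    W_r} G(e^{kappa W_r} v(r, y)) by Lambda A(r)^{1+beta} weight(r) damped(r,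
    y), one factor damped^beta having been replaced by (M r)^beta
    ([source_le], [duhamel_le]). By the semigroup law, propagating [damped r]
    over the remaining time t - r gives exactly [damped t] ([damped_split]).
    So the Duhamel integral is at most [damped t] times the integral over [0,
    t] of Lambda A^{1+beta} weight, and the latter is at most A(t) - 1: with
    y = H(r) as the new variable, A is the solution [riccati] of the equation
    phi' = Lambda phi^{1+beta}, phi(0) = 1 ([integral_primitive_le],
    [integral_amplification_le]).

    The semigroup law S_s S_t f = S_{s+t} f ([killed_mean_semigroup]) must be
    proved for the expectation of [f] along paths killed on leaving [D]. Let
    the motion start afresh at time s, once with its own increments on the
    same sample space, once with those of an independent copy, that is, on
    the square of the sample space. On a dyadic grid both motions have
    independent increments with the same laws, so the two increment vectors
    have the same joint law ([eq_box_law], [confined_law]); this rests on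
    extending the independence of the coordinate processes from cylinder sets
    to the sigma-algebras they generate ([independent_sigma_algebra]).
    Survival up to a given time is a countable union of countable decreasing
    intersections of grid events: by compactness a surviving path stays at
    positive distance from the complement of [D], and that is a closed
    condition, which may be tested at dyadic times
    ([exit_time_gt_confined2]). Continuity of measures then carries the
    equality of laws over to the killed motions ([alive_law]).

    The function [f] may be unbounded near the frontier of [D], so the
    finiteness of S_t f has to be deduced as well. The semigroup law makes
    [M] nonincreasing; hence [M r = +oo] for some r > 0 would give an
    infinite weight on all of [0, r], contradicting the hypothesis
    ([sup_norm_damped_fin_num], [damped_fin_num]). *)

(** * Borel sets of R^d *)

Definition borel_rV (R : realType) (d : nat) :=
  g_sigma_algebraType (@open 'rV[R]_d).

Section borel_rV_theory.
Context (R : realType) (d : nat).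

(** Second countability, with boxes as the basis: this is what reduces Borel
    measurability in R^d to coordinates. *)
Lemma open_eq_bigcup_rat_ball (U : set 'rV[R]_d) : open U ->
  U = \bigcup_(p in [set p : 'rV[rat]_d * rat |
        0 < ratr p.2 :> R /\ ball (map_mx ratr p.1 : 'rV[R]_d) (ratr p.2 : R) `<=` U])
      [set x | forall i, ball (ratr (p.1 0 i) : R) (ratr p.2) (x 0 i)].
Proof.
move=> oU; apply/seteqP; split=> [x Ux|x [[c q] /= [q0 qU] xc]]; last first.
  by apply: qU; split => // i j; rewrite ord1 mxE.
have := open_nbhs_nbhs (conj oU Ux); rewrite -nbhs_ballE => -[e /= e0 eU].
have [q /andP[q0 qe]] : exists q : rat, (0 < ratr q :> R) && (ratr q < e / 2).
  have /(rat_in_itvoo)[q] : (0 : R) < e / 2 by rewrite divr_gt0.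
  by rewrite in_itv/= => qq; exists q.
have cP i : exists c : rat, ball (x 0 i) (ratr q : R) (ratr c : R).
  have /(rat_in_itvoo)[c] : x 0 i < x 0 i + ratr q by rewrite ltrDl.
  rewrite in_itv/= => /andP[c1 c2]; exists c.
  by rewrite /ball/= ltr_distlC (lt_trans _ c1) ?c2// ltrBlDr ltrDl.
have [c cE] := choice cP.
exists (\row_i c i, q) => /=.
  split => // y yc; apply: eU; split => // i j.
  have [_ /(_ i j)] := yc; rewrite ord1 !mxE => yj.
  rewrite [e]splitr; apply: (@ball_triangle _ _ (ratr (c j) : R)).
    by apply: (le_ball (ltW qe)); exact: cE.
  by apply: (le_ball (ltW qe)); exact: yj.
by move=> i; rewrite mxE; exact: ball_sym.
Qed.

Lemma measurable_fun_rVP d' (T : measurableType d') (h : T -> borel_rV R d) :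
  (forall i, measurable_fun setT (fun t => (h t : 'rV[R]_d) 0 i)) ->
  measurable_fun setT h.
Proof.
move=> mh; apply: (@measurability _ _ T (borel_rV R d) setT h (@open 'rV[R]_d)) => //.
move=> _ [U oU <-]; rewrite setTI (open_eq_bigcup_rat_ball oU).
rewrite preimage_bigcup bigcup_mkcond; apply: countable_bigcupT_measurable => [|p].
  exact: countableP.
case: ifPn => // /set_mem[q0 _].
have -> : h @^-1` [set x | forall i, ball (ratr (p.1 0 i) : R) (ratr p.2) (x 0 i)]
   = \bigcap_(i in [set: 'I_d])
       (fun t => (h t : 'rV[R]_d) 0 i) @^-1` ball (ratr (p.1 0 i) : R) (ratr p.2).
  by apply/seteqP; split => t /= H i; [move=> _|]; exact: H.
apply: fin_bigcap_measurable => // i _.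
rewrite -[X in measurable X]setTI; apply: mh => //.
by apply: open_measurable; exact: ball_open.
Qed.

Lemma measurable_open_rV (U : set 'rV[R]_d) : open U ->
  measurable (U : set (borel_rV R d)).
Proof. by move=> oU; apply: sub_sigma_algebra. Qed.

Lemma measurable_closed_rV (U : set 'rV[R]_d) : closed U ->
  measurable (U : set (borel_rV R d)).
Proof.
move=> /closed_openC /measurable_open_rV mU.
by rewrite -(setCK U); exact: measurableC.
Qed.

Lemma measurable_fun_openP d' (T : measurableType d') (D : set T) (g : T -> R) :
  (forall U : set R, open U -> measurable (D `&` g @^-1` U)) ->
  measurable_fun D g.
Proof.
move=> mg; apply: (@measurability _ _ T R D g (@RGenOpens.G R)).
  exact: RGenOpens.measurableE.
by move=> _ [_ [a [b ->]] <-]; apply: mg; exact: interval_open.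
Qed.

Lemma open_measurable_fun (D : set 'rV[R]_d) (g : 'rV[R]_d -> R) :
  open D -> {in D, continuous g} ->
  measurable_fun (D : set (borel_rV R d)) g.
Proof.
move=> oD cg; apply: measurable_fun_openP => U oU.
apply: measurable_open_rV; rewrite openE => x [Dx gx].
apply: filterI; first exact: open_nbhs_nbhs.
apply: (cg x); first exact: mem_set.
exact: open_nbhs_nbhs.
Qed.

Lemma measurable_coord_rV i :
  measurable_fun setT (fun x : borel_rV R d => (x : 'rV[R]_d) 0 i).
Proof.
by apply: open_measurable_fun; [exact: openT|move=> x _; exact: coord_continuous].
Qed.

End borel_rV_theory.

Lemma measurable_fun_rV_comb (R : realType) (d : nat) d' (T : measurableType d')
    (h k : T -> borel_rV R d) (c : R) :
  measurable_fun setT h -> measurable_fun setT k ->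
  measurable_fun setT (fun t => (h t : 'rV[R]_d) + c *: (k t : 'rV[R]_d) : borel_rV R d).
Proof.
move=> mh mk; apply: measurable_fun_rVP => i.
under eq_fun do rewrite !mxE.
apply: measurable_funD.
  by apply: (measurableT_comp (measurable_coord_rV i)).
apply: measurable_funM => //.
by apply: (measurableT_comp (measurable_coord_rV i)).
Qed.

(** The Borel sigma-algebra of R x R^d contains the product one, because the
    projections are continuous; measurability can thus be checked with
    Tonelli's theorem in the product. *)
Lemma measurable_time_spaceW (R : realType) (d : nat) d' (U : measurableType d')
    (v : R * borel_rV R d -> U) : measurable_fun setT v ->
  measurable_fun setT (v : borel_time_space R d -> U).
Proof.
move=> mv.
have m1 : measurable_fun setT (fst : borel_time_space R d -> R).
  apply: measurable_fun_openP => V oV; apply: sub_sigma_algebra; rewrite setTI.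
  by apply: open_comp => // x _; exact: cvg_fst.
have m2 : measurable_fun setT (snd : borel_time_space R d -> borel_rV R d).
  apply: (@measurability _ _ (borel_time_space R d) (borel_rV R d) setT snd
    (@open 'rV[R]_d)) => //.
  move=> _ [V oV <-]; apply: sub_sigma_algebra; rewrite setTI.
  by apply: open_comp => // x _; exact: cvg_snd.
have := measurableT_comp mv (measurable_fun_pair m1 m2).
by apply: eq_measurable_fun => -[].
Qed.

(** * Independent coordinates and increments *)

Section independence_extension.
Context (R : realType) d (T : measurableType d) (P : probability T R) (n : nat).
Variable C : 'I_n -> set (set T).
Hypotheses (CI : forall i, setI_closed (C i)) (CT : forall i, C i setT)
  (Cm : forall i, C i `<=` measurable).
Hypothesis indC : forall E : 'I_n -> set T, (forall i, C i (E i)) ->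
  P (\bigcap_(i in [set: 'I_n]) E i) = (\prod_(i < n) P (E i))%E.

(** The factors are enlarged one after the other. When all but one of the
    events are fixed, both sides are finite measures in the remaining event;
    they agree on a pi-system, hence on the sigma-algebra it generates. *)
Lemma independent_sigma_algebra (E : 'I_n -> set T) :
  (forall i, <<s C i >> (E i)) ->
  P (\bigcap_(i in [set: 'I_n]) E i) = (\prod_(i < n) P (E i))%E.
Proof.
have sm i : <<s C i >> `<=` measurable.
  by apply: smallest_sub => //; exact: sigma_algebra_measurable.
suff H (j : nat) : (j <= n)%N -> forall E : 'I_n -> set T,
    (forall i : 'I_n, (i < j)%N -> <<s C i >> (E i)) ->
    (forall i : 'I_n, (j <= i)%N -> C i (E i)) ->
    P (\bigcap_(i in [set: 'I_n]) E i) = (\prod_(i < n) P (E i))%E.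
  by move=> sE; apply: (H n) => // i; rewrite leqNgt ltn_ord.
elim: j => [_ {}E _ CE|j IH jn {}E sE CE]; first by apply: indC => i; exact: CE.
pose i0 := Ordinal jn.
have mE i : measurable (E i).
  have [ij|ji] := ltnP i j.+1; first by apply: (sm i); exact: sE.
  by apply: (Cm (i := i)); exact: CE.
pose F := \bigcap_(i in [set i | i != i0]) E i.
have mF : measurable F by apply: fin_bigcap_measurable => //; exact: finite_finset.
pose E' (A : set T) := fun i => if i == i0 then A else E i.
have capE A : \bigcap_(i in [set: 'I_n]) E' A i = A `&` F.
  apply/seteqP; split => [x H|x [Ax Fx] i _].
    split; first by have := H i0 I; rewrite /E' eqxx.
    by move=> i /= /negPf ii; have := H i I; rewrite /E' ii.
  by rewrite /E'; case: eqVneq => // ii; exact: Fx.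
have prodE A : (\prod_(i < n) P (E' A i) =
    P A * \prod_(i < n | i != i0) P (E i))%E.
  rewrite (bigD1 i0)//= {1}/E' eqxx; congr (_ * _)%E.
  by apply: eq_bigr => i /negPf ii; rewrite /E' ii.
have c0 : (0 <= \prod_(i < n | i != i0) P (E i))%E.
  by apply: prode_ge0.
have cfin : (\prod_(i < n | i != i0) P (E i))%E \is a fin_num.
  apply: prode_fin_num => i _.
  by apply: fin_num_measure; exact: mE.
pose c := NngNum (fine_ge0 c0).
have key A : <<s C i0 >> A -> mrestr P mF A = mscale c P A.
  apply: (g_sigma_algebra_measure_unique (C i0) (@Cm i0) (fun=> setT)) => //.
  - by rewrite bigcup_const.
  - move=> B CB; rewrite /=/mscale/=/mrestr -capE IH.
    + by rewrite prodE fineK// muleC.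
    + exact: ltnW.
    + move=> i ij; rewrite /E'; case: eqVneq => [ii|_]; last by apply: sE; exact: ltnW.
      by move: ij; rewrite ii/= ltnn.
    + move=> i ij; rewrite /E'; case: eqVneq => [->//|ii]; apply: CE.
      by rewrite ltn_neqAle ij andbT; apply: contra ii => /eqP ji; apply/eqP/val_inj.
  - move=> k; rewrite /=/mrestr setTI.
    by rewrite ltey_eq fin_num_measure.
have EE : E' (E i0) = E by apply/funext => i; rewrite /E'; case: eqVneq => // ->.
rewrite -[in LHS]EE capE -[LHS]/(mrestr P mF (E i0)) key; last exact: sE.
by rewrite -[in RHS]EE prodE /mscale/= fineK// muleC.
Qed.

End independence_extension.

Section brownian_increments.
Context (R : realType) (d : nat) (disp : measure_display)
  (T : measurableType disp) (P : probability T R) (B : R -> T -> 'rV[R]_d).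
Hypothesis BM : brownian_motion_rV P B.

Lemma brownian_coord i : brownian_motion P (fun t w => B t w 0 i).
Proof. by have [+ _] := BM; apply. Qed.

Lemma measurable_brownian_coord t i : 0 <= t ->
  measurable_fun setT (fun w => B t w 0 i).
Proof. exact: bm_measurable (brownian_coord i) t. Qed.

(** Increments of length zero need a separate argument: they vanish, whereas
    [normal_prob 0 0] is not the Dirac mass at 0. *)
Lemma increment_stationary i (s t s' t' : R) (A : set R) :
  0 <= s -> s <= t -> 0 <= s' -> t - s = t' - s' -> measurable A ->
  P [set w | A (B t w 0 i - B s w 0 i)] = P [set w | A (B t' w 0 i - B s' w 0 i)].
Proof.
move=> s0 st s'0 tt mA.
move: st; rewrite le_eqVlt => /predU1P[ts|st].
  have -> : t' = s' by apply/eqP; rewrite -subr_eq0 -tt ts subrr.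
  by rewrite ts; under eq_set do rewrite subrr; under [in RHS]eq_set do rewrite subrr.
have st' : s' < t' by rewrite -subr_gt0 -tt subr_gt0.
rewrite (bm_gaussian (brownian_coord i) s0 st mA).
by rewrite (bm_gaussian (brownian_coord i) s'0 st' mA) tt.
Qed.

(** For one coordinate this is part of the definition of Brownian motion.
    Increment events are not cylinder events, but they belong to the
    sigma-algebra generated by the latter, which gives independence across
    coordinates. *)
Lemma increments_independent (n : nat) (t : nat -> R) (A : 'I_d -> nat -> set R) :
  0 <= t 0%N -> (forall k, t k <= t k.+1) -> (forall i k, measurable (A i k)) ->
  P (\bigcap_(i in [set: 'I_d]) \bigcap_(k < n)
       [set w | A i k (B (t k.+1) w 0 i - B (t k) w 0 i)]) =
  (\prod_(i < d) \prod_(k < n)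
     P [set w | A i k (B (t k.+1) w 0%R i - B (t k) w 0%R i)%R])%E.
Proof.
move=> t0 tS mA.
have t_ge0 k : 0 <= t k by elim: k => // k; move/le_trans; exact.
pose C i := [set E | exists2 Q : nat -> set R, (forall k, measurable (Q k)) &
  E = \bigcap_(k < n.+1) [set w | Q k (B (t k) w 0 i)]].
have mB k i (Q : set R) : measurable Q -> measurable [set w | Q (B (t k) w 0 i)].
  by move=> mQ; rewrite -[X in measurable X]setTI; exact: measurable_brownian_coord.
transitivity (\prod_(i < d) P (\bigcap_(k < n)
    [set w | A i k (B (t k.+1) w 0%R i - B (t k) w 0%R i)%R]))%E; last first.
  apply: eq_bigr => i _.
  exact: (bm_independent (brownian_coord i)).
apply: (@independent_sigma_algebra _ _ _ P d C).
- move=> i _ _ [Q mQ ->] [Q' mQ' ->]; exists (fun k => Q k `&` Q' k).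
    by move=> k; exact: measurableI.
  by rewrite -bigcapI.
- move=> i; exists (fun=> setT) => //.
  by apply/seteqP; split.
- by move=> i _ [Q mQ ->]; apply: bigcap_measurable => [|k _]; [exists 0%N|exact: mB].
- move=> E CE.
  have [Q Q' EQ] : exists2 Q : 'I_d -> nat -> set R,
      (forall i k, measurable (Q i k)) &
      forall i, E i = \bigcap_(k < n.+1) [set w | Q i k (B (t k) w 0 i)].
    have /choice[Q HQ] : forall i, exists Q : nat -> set R, (forall k, measurable (Q k)) /\
        E i = \bigcap_(k < n.+1) [set w | Q k (B (t k) w 0 i)].
      by move=> i; have [Q mQ EQ] := CE i; exists Q.
    by exists Q => i; have [] := HQ i.
  have [_ ind] := BM.
  have := ind n.+1 t Q t_ge0 Q'.
  rewrite (eq_bigcapr (G := E)); last by move=> i _; rewrite EQ.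
  by move=> ->; apply: eq_bigr => i _; rewrite EQ.
move=> i; pose U := g_sigma_algebraType (C i).
have mBk k : (k < n.+1)%N -> measurable_fun setT (fun w : U => B (t k) w 0 i).
  move=> kn _ Q mQ; rewrite setTI; apply: sub_sigma_algebra.
  exists (fun l => if l == k then Q else setT); first by move=> l; case: ifP.
  apply/seteqP; split => [w Qw l _ /=|w /(_ k kn)/=]; last by rewrite eqxx.
  by case: eqP => // ->.
suff : measurable (\bigcap_(k < n)
   [set w | A i k (B (t k.+1) w 0 i - B (t k) w 0 i)] : set U) by [].
apply: bigcap_measurableType => k /= kn.
rewrite -[X in measurable X]setTI.
apply: (measurable_funB (mBk k.+1 _) (mBk k _)) => //.
by rewrite ltnS ltnW.
Qed.

End brownian_increments.

(** * Path regularity and the exit time *)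

(** Rounding the time down to multiples of 1/(n+1) gives functions that are
    measurable by a countable case distinction and converge pointwise. *)
Lemma measurable_caratheodory (R : realType) disp (T : measurableType disp)
    (F : R -> T -> R) :
  (forall t, measurable_fun setT (F t)) -> (forall w, continuous (F^~ w)) ->
  measurable_fun setT (fun p : R * T => F p.1 p.2).
Proof.
move=> mF cF.
pose a n (t : R) : R := (Num.floor (t * n.+1%:R))%:~R / n.+1%:R.
apply: (@measurable_fun_cvg _ _ _ _ (fun n p => F (a n p.1) p.2)) => [n|[t w] _].
  move=> _ Y mY; rewrite setTI.
  have -> : (fun p : R * T => F (a n p.1) p.2) @^-1` Y = \bigcup_(z : int)
     (`[z%:~R / n.+1%:R, (z + 1)%:~R / n.+1%:R[%classic `*`
      (F (z%:~R / n.+1%:R) @^-1` Y)).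
    apply/seteqP; split => [[t w] /= YF|[t w] [z _ [/= + YF]]].
      exists (Num.floor (t * n.+1%:R)) => //=; split => //.
      by rewrite in_itv/= ler_pdivrMr// ltr_pdivlMr// floor_itv.
    rewrite in_itv/= ler_pdivrMr// ltr_pdivlMr// => /floor_def zE.
    by rewrite /a zE.
  apply: countable_bigcupT_measurable => [|z]; first exact: countableP.
  apply: measurableX; first exact: measurable_itv.
  by rewrite -[X in measurable X]setTI; exact: mF.
apply: (cvg_comp (fun n => a n t) (F^~ w)); last exact: cF.
apply/cvgrPdist_lt => e e0; near=> n.
have n0 : (0 : R) < n.+1%:R by [].
rewrite -(@ltr_pM2r _ n.+1%:R)// -[X in _ * X](gtr0_norm n0) -normrM.
rewrite mulrBl /a divfK ?gt_eqF//.
have /andP[f1 f2] := floor_itv (t * n.+1%:R).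
rewrite ger0_norm ?subr_ge0//.
apply: (@lt_le_trans _ _ 1).
  by rewrite ltrBlDr addrC -intrD1.
rewrite -ler_pdivrMr// div1r; apply/ltW.
by near: n; exact: (near_infty_natSinv_lt (PosNum e0)).
Unshelve. all: by end_near. Qed.

(** This is what makes confinement to a closed set a condition on countably
    many times. *)
Lemma dyadic_dense (R : realType) (X : topologicalType) (g : R -> X) (C : set X) :
  continuous g -> closed C ->
  (forall m k, (k <= 2 ^ m)%N -> C (g (k%:R / 2 ^+ m))) ->
  forall u, 0 <= u <= 1 -> C (g u).
Proof.
move=> cg cC Cg u /andP[u0 u1]; apply: contrapT => nC.
have : nbhs u (g @^-1` (~` C)).
  apply: cg; apply: open_nbhs_nbhs; split => //; exact: closed_openC.
rewrite -nbhs_ballE => -[e /= e0 eC].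
have [m _ /(_ m (leqnn m)) /= me] := near_infty_natSinv_expn_lt (PosNum e0).
have u2_ge0 : 0 <= u * 2 ^+ m by rewrite mulr_ge0// exprn_ge0.
have /andP[f1 f2] := truncn_itv u2_ge0.
set k := Num.trunc (u * 2 ^+ m) in f1 f2.
have k2 : (k <= 2 ^ m)%N.
  rewrite -(ler_nat R) natrX (le_trans f1)//.
  by rewrite ler_piMl// exprn_ge0.
apply: (eC (k%:R / 2 ^+ m)) (Cg _ _ k2).
rewrite /ball/=; apply: le_lt_trans me.
have p2 : (0 : R) < 2 ^+ m by rewrite exprn_gt0.
rewrite -(@ler_pM2r _ (2 ^+ m))// -[X in _ * X <= _](gtr0_norm p2) -normrM.
rewrite mulrBl !divfK ?gt_eqF// ger0_norm ?subr_ge0//.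
by rewrite lerBlDr addrC natr1 ltW.
Qed.

(** The points at distance at least 1/(n+1) from the complement of [D]. *)
Definition erosion (R : realType) (d : nat) (D : set 'rV[R]_d) (n : nat) :=
  ~` \bigcup_(y in ~` D) ball y (n.+1%:R^-1 : R).

Section erosion.
Context (R : realType) (d : nat) (D : set 'rV[R]_d).

Lemma closed_erosion n : closed (erosion D n).
Proof.
apply: open_closedC; apply: bigcup_open => y _; apply: ball_open.
Qed.

Lemma erosion_sub n : erosion D n `<=` D.
Proof.
move=> x Kx; apply: contrapT => nDx; apply: Kx; exists x => //.
by apply: ballxx; rewrite invr_gt0.
Qed.

Lemma erosionS m n : (m <= n)%N -> erosion D m `<=` erosion D n.
Proof.
move=> mn; apply: subsetC => x [y nDy yx]; exists y => //.
by apply: le_ball yx; rewrite lef_pV2 ?posrE// ler_nat ltnS.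
Qed.

(** The image of a compact time interval is compact, so it keeps a positive
    distance from the complement of [D]. *)
Lemma compact_erosion (g : R -> 'rV[R]_d) (t : R) : open D -> continuous g ->
  (forall s, 0 <= s <= t -> D (g s)) ->
  exists n, forall s, 0 <= s <= t -> erosion D n (g s).
Proof.
move=> oD cg Dg.
have /compact_near_coveringP/(_ nat \oo (fun n s => erosion D n (g s))) :=
  @segment_compact R 0 t.
case=> [s /= sI|n _ /(_ n (leqnn n)) /= H]; last first.
  by exists n => s sI; apply: H; rewrite /= in_itv.
have /Dg Ds : 0 <= s <= t by rewrite in_itv in sI.
have := open_nbhs_nbhs (conj oD Ds); rewrite -nbhs_ballE => -[e /= e0 eD].
have e20 : 0 < e / 2 by rewrite divr_gt0.
(* Half of the radius for the motion of the path, half for the erosion. *)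
exists (g @^-1` ball (g s) (e / 2), [set n | (n.+1%:R^-1 : R) < e / 2]) => /=.
  split; first by apply: cg; exact: nbhsx_ballx.
  exact: (near_infty_natSinv_lt (PosNum e20)).
move=> [s' n] /= [ss' ne] [y nDy ys']; apply: nDy; apply: eD.
rewrite [e]splitr; apply: ball_triangle ss' _.
by apply: (le_ball (ltW ne)); exact: ball_sym.
Qed.

End erosion.

(** Extending a path by its initial value to negative times gives a function
    continuous everywhere, which spares one-sided limits. *)
Lemma continuous_comp_max0 (R : realType) (g : R -> R) :
  {within `[0, +oo[, continuous g} -> continuous (fun t : R => g (Num.max 0 t)).
Proof.
move=> cg t; apply: (cvg_comp (fun s : R => Num.max 0 s) g).
  2: apply: (subspace_continuousP _ _).1 => //.
  2: by rewrite /= in_itv/= andbT le_max lexx.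
move=> U; rewrite /within/= => UU.
have : \forall s \near t, (`[0, +oo[%classic (Num.max 0 s) -> U (Num.max 0 s)).
  have : Num.max 0 s @[s --> t] --> Num.max 0 t.
    by apply: (@continuous_max _ R (cst 0) id); [exact: cvg_cst|exact: cvg_id].
  by move=> /(_ _ UU).
apply: filterS => s; apply.
by rewrite /= in_itv/= andbT le_max lexx.
Qed.

Section killed_paths.
Context (R : realType) (d : nat) (disp : measure_display)
  (T : measurableType disp) (P : probability T R) (B : R -> T -> 'rV[R]_d)
  (D : set 'rV[R]_d).
Hypotheses (BM : brownian_motion_rV P B) (oD : open D).

Definition brownian_pos (t : R) (w : T) : borel_rV R d := B (Num.max 0 t) w.

Lemma brownian_pos0 w : brownian_pos 0 w = 0.
Proof.
rewrite /brownian_pos maxxx; apply/rowP => i.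
by rewrite (bm_start (brownian_coord BM i)) mxE.
Qed.

Lemma continuous_brownian_pos w :
  continuous (fun t => brownian_pos t w : 'rV[R]_d).
Proof.
move=> t; apply/cvg_ballP => e e0.
have H i j : \forall s \near t, ball ((brownian_pos t w : 'rV[R]_d) i j) e
    ((brownian_pos s w : 'rV[R]_d) i j).
  have /cvg_ballP : (brownian_pos s w : 'rV[R]_d) i j @[s --> t] -->
      (brownian_pos t w : 'rV[R]_d) i j; last by apply.
  rewrite ord1.
  exact: (continuous_comp_max0 (bm_continuous (brownian_coord BM j) (w := w))).
near=> s; split => // i j; move: i j; near: s.
apply: filter_forall => i; apply: filter_forall => j; exact: H.
Unshelve. all: by end_near. Qed.

Lemma measurable_brownian_pos :
  measurable_fun setT (fun p : R * T => brownian_pos p.1 p.2).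
Proof.
apply: measurable_fun_rVP => i.
apply: (@measurable_caratheodory R disp T
  (fun t w => (brownian_pos t w : 'rV[R]_d) 0 i)) => [t|w].
  by apply: (measurable_brownian_coord BM); rewrite le_max lexx.
move=> t; apply: (cvg_comp (fun t => brownian_pos t w : 'rV[R]_d)
  (fun x : 'rV[R]_d => x 0 i) (@continuous_brownian_pos w t)).
exact: coord_continuous.
Qed.

(** Position at time [t] of the path from [x], frozen at negative times so as
    to be jointly measurable on the whole time line. *)
Definition path_pos (x : borel_rV R d) (t : R) (w : T) : borel_rV R d :=
  (x : 'rV[R]_d) + Num.sqrt 2 *: (brownian_pos t w : 'rV[R]_d).

Lemma path_posE x t w : 0 <= t -> path_pos x t w = path_from B x t w.
Proof. by move=> t0; rewrite /path_pos /brownian_pos max_r. Qed.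

Lemma path_pos0 x w : path_pos x 0 w = x.
Proof. by rewrite /path_pos brownian_pos0 scaler0 addr0. Qed.

Lemma continuous_path_pos x w : continuous (fun t => path_pos x t w : 'rV[R]_d).
Proof.
move=> t; apply: cvgD; first exact: cvg_cst.
by apply: cvgZr; exact: continuous_brownian_pos.
Qed.

Lemma measurable_path_pos d' (U : measurableType d') (x : U -> borel_rV R d)
    (t : U -> R) (w : U -> T) :
  measurable_fun setT x -> measurable_fun setT t -> measurable_fun setT w ->
  measurable_fun setT (fun u => path_pos (x u) (t u) (w u)).
Proof.
move=> mx mt mw; apply: measurable_fun_rV_comb => //.
exact: (measurableT_comp measurable_brownian_pos (measurable_fun_pair mt mw)).
Qed.

(** From left to right the definition of the infimum suffices. Conversely,
    survival at time [t] itself gives some time beyond [t], as [D] is open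
    and paths are continuous; this makes the inequality strict. *)
Lemma exit_time_gtP x t w : 0 <= t ->
  (t%:E < exit_time B D x w)%E <-> (forall s, 0 <= s <= t -> D (path_pos x s w)).
Proof.
move=> t0; split=> [tex s /andP[s0 st]|H].
  rewrite path_posE//; apply: contrapT => nD.
  have : (exit_time B D x w <= s%:E)%E by apply: ereal_inf_lbound; exists s.
  move=> /(lt_le_trans tex); rewrite lte_fin.
  by rewrite ltNge st.
have : nbhs t [set s | D (path_pos x s w)].
  apply: continuous_path_pos; apply: open_nbhs_nbhs; split => //.
  by apply: H; rewrite t0 lexx.
rewrite -nbhs_ballE => -[e /= e0 eD].
apply: (@lt_le_trans _ _ (t + e)%:E); first by rewrite lte_fin ltrDl.
apply: le_ereal_inf_tmp => _ [s [s0 nD] <-]; rewrite lee_fin leNgt; apply/negP => se.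
apply: nD; rewrite -path_posE//.
have [st|ts] := leP s t; first by apply: H; rewrite s0.
apply: eD; rewrite /ball/= ltr_distlC; apply/andP; split => //.
by rewrite (le_lt_trans _ ts)// gerBl ltW.
Qed.

(** Unlike the exit event itself, this one is a finite intersection of
    closed conditions on single times. *)
Definition confined (n m : nat) (x : borel_rV R d) (r t : R) (w : T) : Prop :=
  forall k, (k <= 2 ^ m)%N ->
    erosion D n (path_pos x (r + t * (k%:R / 2 ^+ m)) w).

Lemma confinedS_grid n m x r t w : confined n m.+1 x r t w -> confined n m x r t w.
Proof.
move=> H k k2.
have -> : k%:R / 2 ^+ m = (k * 2)%:R / 2 ^+ m.+1 :> R.
  by rewrite natrM exprSr invfM mulrACA divff ?mulr1// pnatr_eq0.
by apply: H; rewrite expnSr leq_mul2r k2 orbT.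
Qed.

Lemma confinedS_erosion n m x r t w :
  confined n m x r t w -> confined n.+1 m x r t w.
Proof. by move=> H k k2; apply: (erosionS (leqnSn n)); exact: H. Qed.

Lemma confinedW n n' m x r t w : (n <= n')%N ->
  confined n m x r t w -> confined n' m x r t w.
Proof. by move=> nn H k k2; apply: (erosionS nn); exact: H. Qed.

Lemma measurable_confined d' (U : measurableType d') n m (x : U -> borel_rV R d)
    (r t : U -> R) (w : U -> T) :
  measurable_fun setT x -> measurable_fun setT r -> measurable_fun setT t ->
  measurable_fun setT w ->
  measurable [set u | confined n m (x u) (r u) (t u) (w u)].
Proof.
move=> mx mr mt mw.
have -> : [set u | confined n m (x u) (r u) (t u) (w u)] =
   \bigcap_(k in [set k | (k <= 2 ^ m)%N])
     (fun u => path_pos (x u) (r u + t u * (k%:R / 2 ^+ m)) (w u)) @^-1` erosion D n.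
  by [].
apply: bigcap_measurableType => k _; rewrite -[X in measurable X]setTI.
apply: measurable_path_pos => //.
- by apply: measurable_funD => //; exact: measurable_funM.
- by apply: measurable_closed_rV; exact: closed_erosion.
Qed.

Lemma dyadic_itv (m k : nat) : (k <= 2 ^ m)%N -> 0 <= (k%:R / 2 ^+ m : R) <= 1.
Proof.
move=> k2; rewrite divr_ge0 ?exprn_ge0//=.
by rewrite ler_pdivrMr ?exprn_gt0// mul1r -natrX ler_nat.
Qed.

Lemma confined_inside n x r t w : 0 <= t -> (forall m, confined n m x r t w) ->
  forall s, 0 <= s <= t -> D (path_pos x (r + s) w).
Proof.
move=> t0 nD s /andP[s0 st]; apply: (@erosion_sub _ _ _ n).
have [t_eq0|t_neq0] := eqVneq t 0.
  have := nD 0%N 0%N isT; rewrite t_eq0 mul0r.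
  by have -> : s = 0 by apply/eqP; rewrite eq_le s0 -{1}t_eq0 st.
have t_gt0 : 0 < t by rewrite lt_neqAle eq_sym t_neq0.
have := @dyadic_dense R _ (fun u => path_pos x (r + t * u) w : 'rV[R]_d) (erosion D n).
have -> : s = t * (s / t) by rewrite mulrC divfK.
apply; last 1 first.
- by rewrite divr_ge0//= ler_pdivrMr// mul1r.
- move=> u; apply: (cvg_comp (fun u => r + t * u) (fun t => path_pos x t w : 'rV[R]_d));
   last exact: continuous_path_pos.
  by apply: cvgD; [exact: cvg_cst|apply: cvgMr; exact: cvg_id].
- exact: closed_erosion.
- by move=> m k; exact: nD.
Qed.

(** Two grids, one on [0, a] and one on [a, a + b], so that the time [a] of
    the Markov property is a grid point at every level. *)
Lemma exit_time_gt_confined2 x a b w : 0 <= a -> 0 <= b ->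
  ((a + b)%:E < exit_time B D x w)%E <->
  exists n, forall m, confined n m x 0 a w /\ confined n m x a b w.
Proof.
move=> a0 b0; rewrite exit_time_gtP ?addr_ge0//; split.
  move=> /(compact_erosion oD (continuous_path_pos (w := w)))[n H].
  exists n => m; split => k /dyadic_itv/andP[k0 k1]; apply: H.
    rewrite add0r mulr_ge0//= (@le_trans _ _ a)// ?lerDl//.
    by rewrite ler_piMr.
  by rewrite addr_ge0// ?mulr_ge0//= lerD2l ler_piMr.
move=> [n nD] s /andP[s0 st]; have [sa|/ltW as_] := leP s a.
  rewrite -[s]add0r; apply: (@confined_inside n _ _ a) => //; last by rewrite s0.
  by move=> m; have [] := nD m.
rewrite -[s](subrKC a); apply: (@confined_inside n _ _ b) => //.
  by move=> m; have [] := nD m.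
by rewrite subr_ge0 as_ lerBlDl.
Qed.

Lemma exit_time_gt_confined x t w : 0 <= t ->
  (t%:E < exit_time B D x w)%E <-> exists n, forall m, confined n m x 0 t w.
Proof.
move=> t0; rewrite -{1}[t]add0r exit_time_gt_confined2//; split=> [][n nD].
  exists n => m k k2; have [_] := nD m; exact.
exists n => m; split => // k k2.
have := nD m 0%N; rewrite !mul0r mulr0; exact.
Qed.

(** Survival jointly in time, starting point and sample, the form needed to
    integrate out the sample by Tonelli's theorem. *)
Definition alive : set ((R * borel_rV R d) * T) :=
  [set p | 0 <= p.1.1 /\ (p.1.1%:E < exit_time B D p.1.2 p.2)%E].

Lemma measurable_alive : measurable alive.
Proof.
have -> : alive = [set p | 0 <= p.1.1] `&`
    \bigcup_n \bigcap_m [set p | confined n m p.1.2 0 p.1.1 p.2].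
  apply/seteqP; split => [[[t x] w] /= [t0]|[[t x] w] /= [t0 [n _ H]]].
    by move=> /exit_time_gt_confined[]// n H; split => //; exists n => // m _; exact: H.
  by split => //; apply/exit_time_gt_confined => //; exists n => m; exact: H.
have m1 : measurable_fun setT (fun p : (R * borel_rV R d) * T => p.1.1).
  exact: (measurableT_comp measurable_fst measurable_fst).
apply: measurableI.
  have -> : [set p : (R * borel_rV R d) * T | 0 <= p.1.1] =
     (fun p => p.1.1) @^-1` `[0, +oo[.
    by apply/funext => p; rewrite /preimage/= in_itv/= andbT.
  by rewrite -[X in measurable X]setTI; apply: m1.
apply: bigcupT_measurable => n; apply: bigcapT_measurable => m.
apply: measurable_confined => //.
exact: (measurableT_comp measurable_snd measurable_fst).
Qed.

End killed_paths.

(** * Markov property of the killed motion *)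

(** Continuity of finite measures, from above in [m] and from below in [n]. *)
Lemma measure_bigcup_bigcap_eq (R : realType) d1 d2 (T1 : measurableType d1)
    (T2 : measurableType d2) (P1 : probability T1 R) (P2 : probability T2 R)
    (E1 : nat -> nat -> set T1) (E2 : nat -> nat -> set T2) :
  (forall n m, measurable (E1 n m)) -> (forall n m, measurable (E2 n m)) ->
  (forall n m, E1 n m.+1 `<=` E1 n m) -> (forall n m, E2 n m.+1 `<=` E2 n m) ->
  (forall n m, E1 n m `<=` E1 n.+1 m) -> (forall n m, E2 n m `<=` E2 n.+1 m) ->
  (forall n m, P1 (E1 n m) = P2 (E2 n m)) ->
  P1 (\bigcup_n \bigcap_m E1 n m) = P2 (\bigcup_n \bigcap_m E2 n m).
Proof.
move=> m1 m2 d1E d2E i1E i2E eqE.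
have cap n : P1 (\bigcap_m E1 n m) = P2 (\bigcap_m E2 n m).
  have c1 : P1 \o E1 n @ \oo --> P1 (\bigcap_m E1 n m).
    apply: nonincreasing_cvg_mu => //.
    - by rewrite ltey_eq fin_num_measure.
    - exact: bigcapT_measurable.
    - by apply/nonincreasing_seqP => m; apply/subsetPset; exact: d1E.
  have c2 : P2 \o E2 n @ \oo --> P2 (\bigcap_m E2 n m).
    apply: nonincreasing_cvg_mu => //.
    - by rewrite ltey_eq fin_num_measure.
    - exact: bigcapT_measurable.
    - by apply/nonincreasing_seqP => m; apply/subsetPset; exact: d2E.
  have e12 : P1 \o E1 n = P2 \o E2 n by apply/funext => m; exact: eqE.
  by rewrite e12 in c1; exact: (cvg_unique _ c1 c2).
pose F1 n := \bigcap_m E1 n m; pose F2 n := \bigcap_m E2 n m.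
have c1 : P1 \o F1 @ \oo --> P1 (\bigcup_n F1 n).
  apply: nondecreasing_cvg_mu.
  - by move=> n; exact: bigcapT_measurable.
  - by apply: bigcupT_measurable => n; exact: bigcapT_measurable.
  - apply/nondecreasing_seqP => n; apply/subsetPset.
    by apply: subset_bigcap => m _; exact: i1E.
have c2 : P2 \o F2 @ \oo --> P2 (\bigcup_n F2 n).
  apply: nondecreasing_cvg_mu.
  - by move=> n; exact: bigcapT_measurable.
  - by apply: bigcupT_measurable => n; exact: bigcapT_measurable.
  - apply/nondecreasing_seqP => n; apply/subsetPset.
    by apply: subset_bigcap => m _; exact: i2E.
have e12 : P1 \o F1 = P2 \o F2 by apply/funext => n; exact: cap.
by rewrite e12 in c1; exact: (cvg_unique _ c1 c2).
Qed.

(** Both integrals are integrals of the absolute value against the law of the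
    integrand extended by 0. An event avoiding the value 0 only involves the
    part of the sample space inside [E1] or [E2], where the laws of [phi1]
    and [phi2] agree; complements handle the events containing 0. *)
Lemma eq_integral_law (R : realType) d1 d2 d3 (T1 : measurableType d1)
    (T2 : measurableType d2) (V : measurableType d3)
    (P1 : probability T1 R) (P2 : probability T2 R)
    (E1 : set T1) (E2 : set T2) (phi1 : T1 -> V) (phi2 : T2 -> V)
    (g : V -> \bar R) :
  measurable E1 -> measurable E2 ->
  measurable_fun setT phi1 -> measurable_fun setT phi2 ->
  measurable_fun setT g -> (forall v, (0 <= g v)%E) ->
  (forall A, measurable A -> P1 (E1 `&` phi1 @^-1` A) = P2 (E2 `&` phi2 @^-1` A)) ->
  (\int[P1]_(w in E1) g (phi1 w) = \int[P2]_(w in E2) g (phi2 w))%E.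
Proof.
move=> mE1 mE2 mphi1 mphi2 mg g0 eqP.
have key d (T : measurableType d) (P : probability T R) (E : set T)
    (phi : T -> V) (mE : measurable E) (mphi : measurable_fun setT phi) :
    exists2 mF : measurable_fun setT ((g \o phi) \_ E),
      (\int[P]_(w in E) g (phi w) =
       \int[pushforward P ((g \o phi) \_ E)]_y `|y|)%E &
      forall C, measurable C -> pushforward P ((g \o phi) \_ E) C =
        if 0%E \in C then (1 - P (E `&` phi @^-1` (g @^-1` (~` C))))%E
        else P (E `&` phi @^-1` (g @^-1` C)).
  have mgp : measurable_fun setT (g \o phi) by exact: measurableT_comp.
  have mF : measurable_fun setT ((g \o phi) \_ E).
    by apply/(measurable_restrictT (g \o phi) mE); exact: measurable_funTS.
  exists mF.
    rewrite ge0_integral_pushforward// preimage_setT.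
    rewrite [LHS]integral_mkcond; apply: eq_integral => w _ /=.
    by rewrite patchE; case: ifP; rewrite ?gee0_abs.
  have H C : 0%E \notin C ->
     ((g \o phi) \_ E) @^-1` C = E `&` phi @^-1` (g @^-1` C).
    move=> C0; apply/seteqP; split => w /=; rewrite patchE.
      by case: ifPn => [/set_mem//|_ /mem_set]; rewrite (negbTE C0).
    by case=> Ew Cw; rewrite mem_set.
  move=> C mC; rewrite /pushforward; case: ifPn => C0; last by rewrite H.
  (* Off [E] the extended integrand is 0, so the complement of [C] is treated. *)
  rewrite -[X in P X]setCK probability_setC.
    have -> : ~` (((g \o phi) \_ E) @^-1` C) = ((g \o phi) \_ E) @^-1` (~` C) by [].
    rewrite H//.
    by apply/negP => /set_mem; apply; exact: set_mem.
  by apply: measurableC; rewrite -[X in measurable X]setTI; exact: mF.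
have [mF1 -> H1] := key _ _ P1 _ _ mE1 mphi1.
have [mF2 -> H2] := key _ _ P2 _ _ mE2 mphi2.
apply: (@eq_measure_integral _ _ _ _
  (measure_function_pushforward__canonical__measure_function_Measure P2 mF2)
  (measure_function_pushforward__canonical__measure_function_Measure P1 mF1)).
move=> C mC _ /=; rewrite H1// H2//.
have mgC : measurable (g @^-1` C) by rewrite -[X in measurable X]setTI; exact: mg.
have mgC' : measurable (g @^-1` ~` C).
  by rewrite -[X in measurable X]setTI; apply: mg => //; exact: measurableC.
by rewrite !eqP.
Qed.

(** Only the first [M] increments of each coordinate are constrained, so that
    infinite sequences can stand for vectors of any length. *)
Definition boxes (R : realType) (d M : nat) : set (set ('I_d -> nat -> R)) :=
  [set E | exists2 A : 'I_d -> nat -> set R, (forall i k, measurable (A i k)) &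
    E = [set y | forall i k, (k < M)%N -> A i k (y i k)]].

(** Boxes form a pi-system, so a law is determined by its values on them. *)
Lemma eq_box_law (R : realType) (d M : nat) d1 d2 (T1 : measurableType d1)
    (T2 : measurableType d2) (P1 : probability T1 R) (P2 : probability T2 R)
    (xi1 : T1 -> 'I_d -> nat -> R) (xi2 : T2 -> 'I_d -> nat -> R) :
  (forall i k, (k < M)%N -> measurable_fun setT (fun w => xi1 w i k)) ->
  (forall i k, (k < M)%N -> measurable_fun setT (fun w => xi2 w i k)) ->
  (forall A : 'I_d -> nat -> set R, (forall i k, measurable (A i k)) ->
    P1 (\bigcap_(i in [set: 'I_d]) \bigcap_(k < M) [set w | A i k (xi1 w i k)]) =
    P2 (\bigcap_(i in [set: 'I_d]) \bigcap_(k < M) [set w | A i k (xi2 w i k)])) ->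
  forall E, <<s @boxes R d M >> E -> P1 (xi1 @^-1` E) = P2 (xi2 @^-1` E).
Proof.
move=> mxi1 mxi2 box E sE.
pose Y := g_sigma_algebraType (@boxes R d M).
have mY d' (T : measurableType d') (xi : T -> 'I_d -> nat -> R) :
    (forall i k, (k < M)%N -> measurable_fun setT (fun w => xi w i k)) ->
    measurable_fun setT (xi : T -> Y).
  move=> mxi; apply: (@measurability _ _ T Y setT xi (@boxes R d M)) => //.
  move=> _ [_ [A mA ->] <-]; rewrite setTI.
  rewrite (_ : _ @^-1` _ = \bigcap_(i in [set: 'I_d]) \bigcap_(k < M)
     (fun w => xi w i k) @^-1` A i k).
    apply: fin_bigcap_measurable => // i _.
    apply: bigcap_measurableType => k kM.
    by rewrite -[X in measurable X]setTI; exact: mxi.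
  by apply/seteqP; split => [w H i _ k kM|w H i k kM]; exact: H.
have := @measure_unique _ R Y (@boxes R d M) (fun=> setT) erefl.
move=> /(_ _ _ _
  (measure_function_pushforward__canonical__measure_function_Measure P1 (mY _ _ _ mxi1))
  (measure_function_pushforward__canonical__measure_function_Measure P2 (mY _ _ _ mxi2))).
apply => //.
- move=> _ _ [A mA ->] [A' mA' ->]; exists (fun i k => A i k `&` A' i k).
    by move=> i k; exact: measurableI.
  apply/seteqP; split => y /=.
    by case=> H H' i k kM; split; [exact: H|exact: H'].
  by move=> H; split => i k kM; have [] := H i k kM.
- move=> _; exists (fun=> fun=> setT) => //.
  by apply/seteqP; split.
- by rewrite bigcup_const.
- move=> _ [A mA ->] /=; rewrite /pushforward.
  have capE T (xi : T -> 'I_d -> nat -> R) :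
      xi @^-1` [set y | forall i k, (k < M)%N -> A i k (y i k)] =
      \bigcap_(i in [set: 'I_d]) \bigcap_(k < M) [set w | A i k (xi w i k)].
    by apply/seteqP; split => [w H i _ k kM|w H i k kM]; exact: H.
  by rewrite !capE box.
- by move=> k /=; rewrite /pushforward preimage_setT probability_setT ltry.
Qed.

Section grid_positions.
Context (R : realType) (d M : nat).
Let Y := g_sigma_algebraType (@boxes R d M).

Definition grid_pos (x : borel_rV R d) (y : 'I_d -> nat -> R) (k : nat) : borel_rV R d :=
  (x : 'rV[R]_d) + Num.sqrt 2 *: (\row_i \sum_(0 <= l < k) y i l).

Lemma measurable_grid_pos x k : (k <= M)%N ->
  measurable_fun setT (fun y : Y => grid_pos x y k).
Proof.
move=> kM; apply: (@measurable_fun_rV_comb _ _ _ Y (cst x)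
  (fun y => \row_i \sum_(0 <= l < k) y i l)) => //.
apply: measurable_fun_rVP => i.
suff : measurable_fun setT (fun y : Y => \sum_(l < k) y i l).
  by apply: eq_measurable_fun => y _; rewrite mxE big_mkord.
apply: measurable_sum => l _ Q mQ; rewrite setTI.
apply: sub_sigma_algebra.
exists (fun i' (l' : nat) => if (i' == i) && (l' == l :> nat) then Q else setT).
  by move=> i' l'; case: ifP.
apply/seteqP; split => [y Qy i' l' l'M /=|y H].
  by case: ifP => // /andP[/eqP -> /eqP ->].
have := H i l (leq_trans (ltn_ord l) kM).
by rewrite !eqxx.
Qed.

End grid_positions.

Section markov.
Context (R : realType) (d : nat) (disp : measure_display)
  (T : measurableType disp) (P : probability T R) (B : R -> T -> 'rV[R]_d)
  (D : set 'rV[R]_d).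
Hypotheses (BM : brownian_motion_rV P B) (oD : open D).

Local Notation path_pos := (path_pos B).
Local Notation confined := (confined B D).

Section grid.
Variables (m : nat) (a b : R).
Hypotheses (a0 : 0 <= a) (b0 : 0 <= b).
Let N := (2 ^ m)%N.
Let grid (c : R) (k : nat) := c * (k%:R / 2 ^+ m).
Let N0 : (0 : R) < 2 ^+ m. Proof. by rewrite exprn_gt0. Qed.

Let gridS c k : 0 <= c -> grid c k <= grid c k.+1.
Proof.
move=> c0; rewrite /grid ler_wpM2l// ler_pM2r ?invr_gt0//.
by rewrite ler_nat.
Qed.

Let grid0 c : grid c 0 = 0. Proof. by rewrite /grid mul0r mulr0. Qed.
Let gridN c : grid c N = c.
Proof. by rewrite /grid natrX divff ?mulr1// gt_eqF. Qed.

Let grid_ge0 c k : 0 <= c -> 0 <= grid c k.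
Proof. by move=> c0; rewrite /grid mulr_ge0// divr_ge0// ltW. Qed.

(** Time at the [k]-th point of the concatenated grids. *)
Let tau (k : nat) : R := grid a (minn k N) + grid b (k - N).

Let tauS k : tau k <= tau k.+1.
Proof.
have [kN|Nk] := ltnP k N.
  rewrite /tau (minn_idPl (ltnW kN)) (minn_idPl kN).
  have -> : (k - N = 0)%N by apply/eqP; rewrite subn_eq0 ltnW.
  have -> : (k.+1 - N = 0)%N by apply/eqP; rewrite subn_eq0.
  by rewrite lerD2r gridS.
rewrite /tau (minn_idPr Nk) (minn_idPr (leqW Nk)) lerD2l subSn//.
exact: gridS.
Qed.

Let tauE1 k : (k <= N)%N -> tau k = 0 + a * (k%:R / 2 ^+ m).
Proof.
move=> kN; rewrite /tau (minn_idPl kN).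
have -> : (k - N = 0)%N by apply/eqP; rewrite subn_eq0.
by rewrite grid0 addrC.
Qed.

Let tauE2 k : tau (N + k) = a + b * (k%:R / 2 ^+ m).
Proof. by rewrite /tau addKn (minn_idPr (leq_addr _ _)) gridN. Qed.

Let tau_ge0 k : 0 <= tau k.
Proof. by rewrite addr_ge0// grid_ge0. Qed.

Let incr1 (w : T) (i : 'I_d) (k : nat) : R :=
  B (tau k.+1) w 0 i - B (tau k) w 0 i.

(** The first component drives the motion up to time [a], the second one, shifted
   by the same number of grid points, drives it afterwards. *)
Let incr2 (w : T * T) (i : 'I_d) (k : nat) : R :=
  (B (grid a (minn k.+1 N)) w.1 0 i + B (grid b (k.+1 - N)) w.2 0 i) -
  (B (grid a (minn k N)) w.1 0 i + B (grid b (k - N)) w.2 0 i).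

Let B0 w i : B 0 w 0 i = 0. Proof. exact: (bm_start (brownian_coord BM i)). Qed.

Let grid_pos1 x w k : grid_pos x (incr1 w) k = path_pos x (tau k) w.
Proof.
rewrite path_posE// /path_from /grid_pos; congr (_ + _ *: _); apply/rowP => i.
rewrite mxE /incr1 telescope_sumr//.
by rewrite /tau min0n sub0n !grid0 addr0 B0 subr0.
Qed.

Let grid_pos2 x w k : grid_pos x (incr2 w) k =
  path_pos (path_pos x (grid a (minn k N)) w.1) (grid b (k - N)) w.2.
Proof.
rewrite !path_posE ?grid_ge0// /path_from /grid_pos -addrA -scalerDr.
congr (_ + _ *: _); apply/rowP => i.
rewrite !mxE /incr2 (telescope_sumr (fun k =>
  B (grid a (minn k N)) w.1 0 i + B (grid b (k - N)) w.2 0 i))//.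
by rewrite min0n sub0n !grid0 !B0 addr0 subr0.
Qed.

Let mB d' (U : measurableType d') (h : U -> T) t i : 0 <= t ->
  measurable_fun setT h -> measurable_fun setT (fun u => B t (h u) 0 i).
Proof.
by move=> t0 mh; apply: (measurableT_comp (measurable_brownian_coord BM i t0) mh).
Qed.

(** On the left, increments over disjoint intervals are independent; on the
   right, the two halves live on different factors.  The factors of both products
   agree, by stationarity for the second half. *)
Let box_law (A : 'I_d -> nat -> set R) : (forall i k, measurable (A i k)) ->
  P (\bigcap_(i in [set: 'I_d]) \bigcap_(k < N + N) [set w | A i k (incr1 w i k)]) =
  (P \x P)%E (\bigcap_(i in [set: 'I_d])
                 \bigcap_(k < N + N) [set w | A i k (incr2 w i k)]).
Proof.
move=> mA.
rewrite (@increments_independent _ _ _ _ _ _ BM _ tau)//.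
pose E1 := \bigcap_(i in [set: 'I_d]) \bigcap_(k < N)
  [set w | A i k (B (grid a k.+1) w 0 i - B (grid a k) w 0 i)].
pose E2 := \bigcap_(i in [set: 'I_d]) \bigcap_(k < N)
  [set w | A i (N + k)%N (B (grid b k.+1) w 0 i - B (grid b k) w 0 i)].
have mE (c : R) (A' : 'I_d -> nat -> set R) : 0 <= c -> (forall i k, measurable (A' i k)) ->
    measurable (\bigcap_(i in [set: 'I_d]) \bigcap_(k < N)
      [set w | A' i k (B (grid c k.+1) w 0 i - B (grid c k) w 0 i)]).
  move=> c0 mA'; apply: fin_bigcap_measurable => // i _.
  apply: bigcap_measurableType => k _; rewrite -[X in measurable X]setTI.
  by apply: measurable_funB => //; apply: mB => //; exact: grid_ge0.
have -> : \bigcap_(i in [set: 'I_d]) \bigcap_(k < N + N) [set w | A i k (incr2 w i k)]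
    = E1 `*` E2.
  have inc1 w i k : (k < N)%N -> incr2 w i k =
      B (grid a k.+1) w.1 0 i - B (grid a k) w.1 0 i.
    move=> kN; rewrite /incr2 (minn_idPl (ltnW kN)) (minn_idPl kN).
    have -> : (k - N = 0)%N by apply/eqP; rewrite subn_eq0 ltnW.
    have -> : (k.+1 - N = 0)%N by apply/eqP; rewrite subn_eq0.
    by rewrite grid0 B0 !addr0.
  have inc2 w i k : incr2 w i (N + k) =
      B (grid b k.+1) w.2 0 i - B (grid b k) w.2 0 i.
    rewrite /incr2 -addnS !addKn !(minn_idPr (leq_addr _ _)).
    by rewrite opprD addrACA subrr add0r.
  apply/seteqP; split => [w H|w [H1 H2] i _ k /= kM].
    split => i _ k /= kN.
      by rewrite -inc1//; apply: H => //=; rewrite ltn_addr.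
    by rewrite -inc2; apply: H => //=; rewrite ltn_add2l.
  have [kN|Nk] := ltnP k N; first by rewrite inc1//; exact: H1.
  rewrite -(subnKC Nk) inc2; apply: H2 => //=.
  by rewrite ltn_subLR.
have -> : (P \x P)%E (E1 `*` E2) = (P E1 * P E2)%E.
  by apply: product_measure1E; [exact: (mE a A)|exact: (mE b (fun i k => A i (N + k)%N))].
have -> : P E1 = (\prod_(i < d) \prod_(k < N)
    P [set w | A i k (B (grid a k.+1) w 0%R i - B (grid a k) w 0%R i)%R])%E.
  by apply: (increments_independent BM) => [|k|]; rewrite ?grid0 ?gridS.
have -> : P E2 = (\prod_(i < d) \prod_(k < N)
    P [set w | A i (N + k)%N (B (grid b k.+1) w 0%R i - B (grid b k) w 0%R i)%R])%E.
  apply: (@increments_independent _ _ _ _ _ _ BM N (grid b)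
    (fun i k => A i (N + k)%N)) => [|k|//]; by rewrite ?grid0 ?gridS.
rewrite -big_split/=; apply: eq_bigr => i _; rewrite big_split_ord/=.
congr (_ * _)%E; apply: eq_bigr => -[k kN] _ /=.
  by rewrite (tauE1 kN) (tauE1 (ltnW kN)) !add0r.
rewrite -addnS !tauE2; apply: (increment_stationary BM) => //.
- by rewrite addr_ge0// grid_ge0.
- by rewrite lerD2l; exact: gridS.
- exact: grid_ge0.
- by rewrite opprD addrACA subrr add0r.
Qed.

(** The grid event and the final position are functions of the increments on
    the grid; the claim is an instance of [eq_box_law]. *)
Lemma confined_law n x (A : set (borel_rV R d)) : measurable A ->
  P [set w | [/\ confined n m x 0 a w, confined n m x a b w &
                 A (path_pos x (a + b) w)]] =
  (P \x P)%E [set w | [/\ confined n m x 0 a w.1,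
                 confined n m (path_pos x a w.1) 0 b w.2 &
                 A (path_pos (path_pos x a w.1) b w.2)]].
Proof.
move=> mA.
pose Y := g_sigma_algebraType (@boxes R d (N + N)).
pose E : set Y := [set y | [/\
  forall k, (k <= N)%N -> erosion D n (grid_pos x y k),
  forall k, (k <= N)%N -> erosion D n (grid_pos x y (N + k)) &
  A (grid_pos x y (N + N))]].
have mE : measurable E.
  have mK k : (k <= N + N)%N -> measurable [set y : Y | erosion D n (grid_pos x y k)].
    move=> kN; rewrite -[X in measurable X]setTI.
    apply: (measurable_grid_pos x kN) => //; apply: measurable_closed_rV.
    exact: closed_erosion.
  have -> : E = (\bigcap_(k in [set k | (k <= N)%N])
        [set y : Y | erosion D n (grid_pos x y k)]) `&`
      ((\bigcap_(k in [set k | (k <= N)%N])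
        [set y : Y | erosion D n (grid_pos x y (N + k))]) `&`
      ((fun y : Y => grid_pos x y (N + N)) @^-1` A)).
    by apply/seteqP; split => y [H1]; [move=> H2 H3|move=> [H2 H3]].
  apply: measurableI; last apply: measurableI.
  - apply: bigcap_measurableType => k kN; apply: mK.
    by rewrite (leq_trans kN)// leq_addr.
  - apply: bigcap_measurableType => k kN; apply: mK.
    by rewrite leq_add2l.
  - rewrite -[X in measurable X]setTI.
    exact: (measurable_grid_pos x (leqnn _)).
have := @eq_box_law R d (N + N) _ _ _ _ P (P \x P)%E incr1 incr2.
move=> /(_ _ _ box_law E mE).
have -> : incr1 @^-1` E = [set w | [/\ confined n m x 0 a w, confined n m x a b w &
                 A (path_pos x (a + b) w)]].
  apply/funext => w; apply/propext; rewrite /E /preimage/= grid_pos1 tauE2.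
  rewrite natrX divff ?gt_eqF// mulr1.
  split=> -[H1 H2 H3]; split => // k kN.
  - by have := H1 k kN; rewrite grid_pos1 tauE1.
  - by have := H2 k kN; rewrite grid_pos1 tauE2.
  - by rewrite grid_pos1 tauE1//; exact: H1.
  - by rewrite grid_pos1 tauE2; exact: H2.
have -> : incr2 @^-1` E = [set w | [/\ confined n m x 0 a w.1,
                 confined n m (path_pos x a w.1) 0 b w.2 &
                 A (path_pos (path_pos x a w.1) b w.2)]].
  have gp1 w k : (k <= N)%N -> grid_pos x (incr2 w) k =
      path_pos x (0 + a * (k%:R / 2 ^+ m)) w.1.
    move=> kN; rewrite grid_pos2 (minn_idPl kN).
    have -> : (k - N = 0)%N by apply/eqP; rewrite subn_eq0.
    by rewrite grid0 (path_pos0 BM) add0r.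
  have gp2 w k : grid_pos x (incr2 w) (N + k) =
      path_pos (path_pos x a w.1) (0 + b * (k%:R / 2 ^+ m)) w.2.
    by rewrite grid_pos2 (minn_idPr (leq_addr _ _)) gridN addKn add0r.
  apply/funext => w; apply/propext; rewrite /E /preimage/= gp2.
  rewrite natrX divff ?gt_eqF// mulr1 add0r.
  split=> -[H1 H2 H3]; split => // k kN.
  - by rewrite -gp1//; exact: H1.
  - by rewrite -gp2//; exact: H2.
  - by rewrite gp1//; exact: H1.
  - by rewrite gp2; exact: H2.
apply.
- move=> i k _; apply: measurable_funB; apply: mB => //.
- move=> i k _; apply: measurable_funB; apply: measurable_funD; apply: mB => //;
    exact: grid_ge0.
Qed.

End grid.

End markov.

Section markov_property.
Context (R : realType) (d : nat) (disp : measure_display)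
  (T : measurableType disp) (P : probability T R) (B : R -> T -> 'rV[R]_d)
  (D : set 'rV[R]_d).
Hypotheses (BM : brownian_motion_rV P B) (oD : open D).

Local Notation path_pos := (path_pos B).
Local Notation confined := (confined B D).

Definition alive_at (x : borel_rV R d) (t : R) : set T :=
  [set w | (t%:E < exit_time B D x w)%E].

Lemma measurable_alive_at x t : 0 <= t -> measurable (alive_at x t).
Proof.
move=> t0.
have -> : alive_at x t = (fun w => ((t, x), w)) @^-1` alive B D.
  by apply/seteqP; split => w //= [].
rewrite -[X in measurable X]setTI.
by apply: (pair1_measurable (t, x : borel_rV R d)) => //; exact: (measurable_alive BM oD).
Qed.

Lemma measurable_path_pos_at x t : measurable_fun setT (path_pos x t).
Proof.
by apply: (@measurable_path_pos _ _ _ _ _ _ BM _ T (cst x) (cst t) id).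
Qed.

(** Both survival events are countable unions of decreasing intersections of
    grid events, whose probabilities agree by [confined_law]. *)
Lemma alive_law x (a b : R) (A : set (borel_rV R d)) : 0 <= a -> 0 <= b ->
  measurable A ->
  P (alive_at x (a + b) `&` path_pos x (a + b) @^-1` A) =
  (P \x P)%E ([set w | alive_at x a w.1 /\ alive_at (path_pos x a w.1) b w.2] `&`
     (fun w => path_pos (path_pos x a w.1) b w.2) @^-1` A).
Proof.
move=> a0 b0 mA.
pose E1 n m := [set w | [/\ confined n m x 0 a w, confined n m x a b w &
                 A (path_pos x (a + b) w)]].
pose E2 n m := [set w : T * T | [/\ confined n m x 0 a w.1,
                 confined n m (path_pos x a w.1) 0 b w.2 &
                 A (path_pos (path_pos x a w.1) b w.2)]].
have m1 n m : measurable (E1 n m).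
  have -> : E1 n m = [set w | confined n m x 0 a w] `&`
      ([set w | confined n m x a b w] `&` path_pos x (a + b) @^-1` A).
    by apply/seteqP; split => w [H1]; [move=> H2 H3|move=> [H2 H3]].
  apply: measurableI; first by apply: (@measurable_confined _ _ _ _ _ _ D BM _ _ n m
    (cst x) (cst 0) (cst a) id).
  apply: measurableI; first by apply: (@measurable_confined _ _ _ _ _ _ D BM _ _ n m
    (cst x) (cst a) (cst b) id).
  by rewrite -[X in measurable X]setTI; exact: measurable_path_pos_at.
have mp : measurable_fun setT (fun w : T * T => path_pos x a w.1).
  by apply: (@measurable_path_pos _ _ _ _ _ _ BM _ _ (cst x) (cst a) fst).
have m2 n m : measurable (E2 n m).
  have -> : E2 n m = [set w | confined n m x 0 a w.1] `&`
      ([set w | confined n m (path_pos x a w.1) 0 b w.2] `&`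
       (fun w => path_pos (path_pos x a w.1) b w.2) @^-1` A).
    by apply/seteqP; split => w [H1]; [move=> H2 H3|move=> [H2 H3]].
  apply: measurableI; first by apply: (@measurable_confined _ _ _ _ _ _ D BM _ _ n m
    (cst x) (cst 0) (cst a) fst).
  apply: measurableI; first by apply: (@measurable_confined _ _ _ _ _ _ D BM _ _ n m
    (fun w => path_pos x a w.1) (cst 0) (cst b) snd).
  rewrite -[X in measurable X]setTI.
  by apply: (@measurable_path_pos _ _ _ _ _ _ BM _ _
    (fun w => path_pos x a w.1) (cst b) snd).
have -> : alive_at x (a + b) `&` path_pos x (a + b) @^-1` A =
    \bigcup_n \bigcap_m E1 n m.
  apply/seteqP; split => w.
    case=> /(exit_time_gt_confined2 BM oD _ _ a0 b0)[n H] Aw.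
    by exists n => // m _; have [H1 H2] := H m; split.
  move=> [n _ H]; split; last by have [] := H 0%N I.
  apply/(exit_time_gt_confined2 BM oD _ _ a0 b0); exists n => m.
  by have [] := H m I.
have -> : [set w | alive_at x a w.1 /\ alive_at (path_pos x a w.1) b w.2] `&`
     (fun w => path_pos (path_pos x a w.1) b w.2) @^-1` A = \bigcup_n \bigcap_m E2 n m.
  apply/seteqP; split => w.
    case=> -[/(exit_time_gt_confined BM oD _ _ a0)[n H]].
    move=> /(exit_time_gt_confined BM oD _ _ b0)[n' H'] Aw.
    exists (maxn n n') => // m _; split => //.
      by apply: (confinedW _ (H m)); rewrite leq_maxl.
    by apply: (confinedW _ (H' m)); rewrite leq_maxr.
  move=> [n _ H]; split; last by have [] := H 0%N I.
  split.
    by apply/(exit_time_gt_confined BM oD _ _ a0); exists n => m; have [] := H m I.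
  by apply/(exit_time_gt_confined BM oD _ _ b0); exists n => m; have [] := H m I.
apply: measure_bigcup_bigcap_eq => //.
- by move=> n m w [H1 H2 H3]; split => //; exact: confinedS_grid.
- by move=> n m w [H1 H2 H3]; split => //; exact: confinedS_grid.
- by move=> n m w [H1 H2 H3]; split => //; exact: confinedS_erosion.
- by move=> n m w [H1 H2 H3]; split => //; exact: confinedS_erosion.
- by move=> n m; exact: (confined_law D BM).
Qed.

(** The killed semigroup on extended-real functions: S_t f is one, as it may
    be infinite somewhere, and the semigroup law applies S_s to it. *)
Definition killed_mean (t : R) (g : borel_rV R d -> \bar R) (x : borel_rV R d) :=
  (\int[P]_(w in alive_at x t) g (path_pos x t w))%E.

(** Tonelli's theorem turns the iterated expectation on the left into one
    over two independent copies, to which [alive_law] applies. *)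
Lemma killed_mean_semigroup (a b : R) (g : borel_rV R d -> \bar R) x :
  0 <= a -> 0 <= b -> measurable_fun setT g -> (forall y, 0 <= g y)%E ->
  killed_mean a (killed_mean b g) x = killed_mean (a + b) g x.
Proof.
move=> a0 b0 mg g0.
pose E := [set w : T * T | alive_at x a w.1 /\ alive_at (path_pos x a w.1) b w.2].
pose phi (w : T * T) := path_pos (path_pos x a w.1) b w.2.
have mp : measurable_fun setT (fun w : T * T => path_pos x a w.1).
  by apply: (@measurable_path_pos _ _ _ _ _ _ BM _ _ (cst x) (cst a) fst).
have mphi : measurable_fun setT phi.
  by apply: (@measurable_path_pos _ _ _ _ _ _ BM _ _
    (fun w => path_pos x a w.1) (cst b) snd).
have mE : measurable E.
  have -> : E = (alive_at x a `*` setT) `&`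
     (fun w : T * T => ((b, path_pos x a w.1), w.2)) @^-1` alive B D.
    apply/seteqP; split => w /=; first by case=> H1 H2; split.
    by case=> -[H1 _] [_ H2]; split.
  apply: measurableI; first by apply: measurableX => //; exact: measurable_alive_at.
  rewrite -[X in measurable X]setTI.
  have mf : measurable_fun setT
      (fun w : T * T => ((b, path_pos x a w.1) : R * borel_rV R d, w.2)).
    by apply: measurable_fun_pair => //; exact: measurable_fun_pair.
  by apply: mf => //; exact: (measurable_alive BM oD).
rewrite /killed_mean.
rewrite (@eq_integral_law R _ _ _ _ _ _ P (P \x P)%E (alive_at x (a + b)) E
  (path_pos x (a + b)) phi g) //; last first.
- by move=> A mA; exact: alive_law.
- exact: measurable_path_pos_at.
- by apply: measurable_alive_at; exact: addr_ge0.
rewrite integral_mkcond [RHS]integral_mkcond.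
have mgp : measurable_fun setT ((g \o phi) \_ E).
  apply/(measurable_restrictT (g \o phi) mE); apply: measurable_funTS.
  exact: measurableT_comp.
rewrite [RHS](fubini_tonelli1 _ mgp); last first.
  by move=> w; rewrite patchE; case: ifP => // _; exact: g0.
apply: eq_integral => w _; rewrite patchE; case: ifPn => [/set_mem aw|/negP aw].
  rewrite integral_mkcond; apply: eq_integral => w' _.
  rewrite !patchE; have -> // : ((w, w') \in E) = (w' \in alive_at (path_pos x a w) b).
  by apply/idP/idP => /set_mem H; apply/mem_set; [case: H|split].
rewrite /fubini_F integral0_eq// => w' _; rewrite patchE.
by case: ifPn => // /set_mem[/= /mem_set].
Qed.

End markov_property.

(** * Killed expectations *)

Section killed_mean_theory.
Context (R : realType) (d : nat) (disp : measure_display)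
  (T : measurableType disp) (P : probability T R) (B : R -> T -> 'rV[R]_d)
  (D : set 'rV[R]_d).
Hypotheses (BM : brownian_motion_rV P B) (oD : open D).

Local Notation path_pos := (path_pos B).
Local Notation killed_mean := (killed_mean P B D).
Local Notation alive_at := (alive_at B D).
Implicit Types (t : R) (x y : borel_rV R d) (g : borel_rV R d -> \bar R).

Lemma alive_at_inside t x w : 0 <= t -> alive_at x t w -> D (path_pos x t w).
Proof. by move=> t0 /(exit_time_gtP BM oD _ _ t0); apply; rewrite t0 lexx. Qed.

Lemma eq_killed_mean t x g g' : 0 <= t -> (forall y, D y -> g y = g' y) ->
  killed_mean t g x = killed_mean t g' x.
Proof.
move=> t0 gg; apply: eq_integral => w /set_mem aw.
by apply: gg; exact: alive_at_inside.
Qed.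

Lemma killed_semigroupE t x (g : 'rV[R]_d -> R) : 0 <= t ->
  killed_semigroup P B D t g x = killed_mean t (EFin \o g) x.
Proof. by move=> t0; apply: eq_integral => w _; rewrite /= path_posE. Qed.

Lemma measurable_comp_path t x g (A : set T) : measurable_fun setT g ->
  measurable_fun A (g \o path_pos x t).
Proof.
move=> mg; apply: measurable_funTS; apply: measurableT_comp => //.
exact: (measurable_path_pos_at BM).
Qed.

Lemma killed_mean_ge0 t x g : 0 <= t -> (forall y, D y -> 0 <= g y)%E ->
  (0 <= killed_mean t g x)%E.
Proof.
by move=> t0 g0; apply: integral_ge0 => w aw; apply: g0; exact: alive_at_inside.
Qed.

Lemma le_killed_mean t x g g' : 0 <= t ->
  measurable_fun setT g -> measurable_fun setT g' ->
  (forall y, D y -> 0 <= g y)%E -> (forall y, D y -> g y <= g' y)%E ->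
  (killed_mean t g x <= killed_mean t g' x)%E.
Proof.
move=> t0 mg mg' g0 gg; apply: ge0_le_integral.
- exact: (measurable_alive_at BM oD).
- by move=> w aw; apply: g0; exact: alive_at_inside.
- exact: measurable_comp_path.
- exact: measurable_comp_path.
- by move=> w aw; apply: gg; exact: alive_at_inside.
Qed.

Lemma killed_meanZ t x g (c : R) : 0 <= t -> 0 <= c ->
  measurable_fun setT g -> (forall y, D y -> 0 <= g y)%E ->
  (killed_mean t (fun y => c%:E * g y) x = c%:E * killed_mean t g x)%E.
Proof.
move=> t0 c0 mg g0; apply: ge0_integralZl_EFin => //.
- exact: (measurable_alive_at BM oD).
- by move=> w aw; apply: g0; exact: alive_at_inside.
- exact: measurable_comp_path.
Qed.

Lemma killed_mean_le_sup t x g (M : \bar R) : 0 <= t -> (0 <= M)%E ->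
  measurable_fun setT g -> (forall y, D y -> 0 <= g y)%E ->
  (forall y, D y -> g y <= M)%E ->
  (killed_mean t g x <= M)%E.
Proof.
move=> t0 M0 mg g0 gM.
apply: (le_trans (le_killed_mean (g' := cst M) _ t0 mg _ g0 gM)) => //.
have mA : measurable (alive_at x t) by exact: (measurable_alive_at BM oD).
rewrite /killed_mean integral_cst//=.
rewrite -[leRHS]mule1; apply: lee_wpmul2l => //.
exact: probability_le1.
Qed.

(** A path started in the open set [D] survives at time 0 for every sample. *)
Lemma killed_mean0 x g : D x -> killed_mean 0 g x = g x.
Proof.
move=> Dx; rewrite /killed_mean.
have -> : alive_at x 0 = setT.
  apply/seteqP; split => // w _; apply/(exit_time_gtP BM oD) => // s s0.
  have -> : s = 0 by apply/eqP; rewrite eq_sym eq_le.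
  by rewrite (path_pos0 BM).
under eq_integral do rewrite (path_pos0 BM).
by rewrite integral_cst//= probability_setT mule1.
Qed.

Lemma cvg_killed_mean t x (g : (borel_rV R d -> \bar R)^nat) g' : 0 <= t ->
  (forall n, measurable_fun setT (g n)) ->
  (forall n y, D y -> 0 <= g n y)%E ->
  (forall y, D y -> nondecreasing_seq (g ^~ y)) ->
  (forall y, D y -> g n y @[n --> \oo] --> g' y) ->
  killed_mean t (g n) x @[n --> \oo] --> killed_mean t g' x.
Proof.
move=> t0 mg g0 ndg cg.
have -> : killed_mean t g' x = killed_mean t (fun y => limn (g ^~ y)) x.
  by apply: eq_killed_mean => // y Dy; apply/esym/cvg_lim => //; exact: cg.
apply: (@cvg_monotone_convergence _ _ _ P _ _ (fun n w => g n (path_pos x t w))).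
- exact: (measurable_alive_at BM oD).
- by move=> n; exact: measurable_comp_path.
- by move=> n w aw; apply: g0; exact: alive_at_inside.
- by move=> w aw; apply: ndg; exact: alive_at_inside.
Qed.

Lemma measurable_killed_mean d' (U : measurableType d') (t : U -> R)
    (x : U -> borel_rV R d) (g : U * borel_rV R d -> \bar R) :
  (forall u, 0 <= t u) -> measurable_fun setT t -> measurable_fun setT x ->
  measurable_fun setT g -> (forall p, 0 <= g p)%E ->
  measurable_fun setT (fun u => killed_mean (t u) (fun y => g (u, y)) (x u)).
Proof.
move=> t0 mt mx mg g0.
pose A : set (U * T) := (fun p => ((t p.1, x p.1), p.2)) @^-1` alive B D.
pose G (p : U * T) := g (p.1, path_pos (x p.1) (t p.1) p.2).
have mx1 : measurable_fun setT (fun p : U * T => x p.1) by exact: measurableT_comp.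
have mt1 : measurable_fun setT (fun p : U * T => t p.1) by exact: measurableT_comp.
have mA : measurable A.
  rewrite -[X in measurable X]setTI.
  have mf : measurable_fun setT (fun p : U * T => ((t p.1, x p.1), p.2)).
    by apply: measurable_fun_pair => //; exact: measurable_fun_pair.
  by apply: mf => //; exact: (measurable_alive BM oD).
have mG : measurable_fun setT G.
  apply: (measurableT_comp mg); apply: measurable_fun_pair => //.
  by apply: (measurable_path_pos BM).
have mGA : measurable_fun setT (G \_ A).
  by apply/(measurable_restrictT G mA); exact: measurable_funTS.
have := @measurable_fun_fubini_tonelli_F _ _ _ _ _ P (G \_ A) mGA.
have GA0 p : (0 <= (G \_ A) p)%E.
  by rewrite patchE; case: ifP => // _; exact: g0.
move=> /(_ GA0); apply: eq_measurable_fun => u _.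
rewrite /fubini_F /killed_mean [RHS]integral_mkcond; apply: eq_integral => w _.
rewrite !patchE; have -> // : ((u, w) \in A) = (w \in alive_at (x u) (t u)).
apply/idP/idP => /set_mem H; apply/mem_set; first by case: H.
by split => /=.
Qed.

End killed_mean_theory.

(** * A comparison integral and the Riccati profile *)

Lemma le_add_eps (R : realType) (x : \bar R) (y K : R) :
  (forall n : nat, (x <= (y + K / n.+1%:R)%:E)%E) -> (x <= y%:E)%E.
Proof.
move=> H; apply/lee_addgt0Pr => e e0; rewrite -EFinD.
have K0 : 0 < `|K| + 1 by rewrite ltr_wpDl.
have [n _ /(_ n (leqnn n)) /= ne] :=
  near_infty_natSinv_lt (PosNum (divr_gt0 e0 K0)).
apply: (le_trans (H n)); rewrite lee_fin lerD2l.
apply: (@le_trans _ _ ((`|K| + 1) / n.+1%:R)).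
  by rewrite ler_pM2r ?invr_gt0// (le_trans (ler_norm K))// lerDl.
by rewrite mulrC -ler_pdivlMr// ltW.
Qed.

Section integral_primitive.
Context (R : realType).
Notation mu := (@lebesgue_measure R).
Variables (h : R -> R) (t : R) (phi psi : R -> R).
Hypotheses (t0 : 0 <= t) (h0 : forall r, 0 <= h r)
  (ih : mu.-integrable `[0, t] (EFin \o h)).
Let H r := (\int[mu]_(x in `[0, r]) h x)%R.
Hypotheses (mpsi : measurable_fun setT psi) (psi0 : 0 <= psi 0)
  (psi_nd : forall y z, 0 <= y -> y <= z -> z <= H t -> psi y <= psi z)
  (psi_phi : forall y z, 0 <= y -> y <= z -> z <= H t ->
     psi y * (z - y) <= phi z - phi y).

Let itvS r : r <= t -> `[0, r] `<=` `[0, t].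
Proof. by move=> rt; apply: subset_itvl; rewrite bnd_simp. Qed.

Let H_diff r s : 0 <= r -> r <= s -> s <= t ->
  (\int[mu]_(x in `]r, s]) (h x)%:E = (H s - H r)%:E)%E.
Proof.
move=> r0 rs st.
have is_ : mu.-integrable `[0, s] (EFin \o h) by apply: integrableS ih => //; exact: itvS.
rewrite /H (@Rintegral_itvB _ _ (BLeft 0) (BRight s) r)//.
rewrite /Rintegral fineK//; apply: integrable_fin_num => //.
apply: integrableS is_ => // x /=; rewrite !in_itv/= => /andP[rx ->].
by rewrite (le_trans r0 (ltW rx)).
Qed.

Let H_ge0 r : 0 <= H r.
Proof. by apply: Rintegral_ge0. Qed.

Let H_nd r s : 0 <= r -> r <= s -> s <= t -> H r <= H s.
Proof.
move=> r0 rs st; rewrite -subr_ge0 -lee_fin -H_diff//.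
by apply: integral_ge0 => x _; rewrite lee_fin.
Qed.

Let H0 : H 0 = 0.
Proof. by rewrite /H set_itv1 Rintegral_set1. Qed.

Let cH : {within `[0, t], continuous H}.
Proof. exact: (@parameterized_integral_continuous R 0 t h t0 ih). Qed.

Let mH : measurable_fun `[0, t] H.
Proof. by apply: subspace_continuous_measurable_fun. Qed.

Let mg : measurable_fun `[0, t] (fun r => (psi (H r) * h r)%:E).
Proof.
apply/measurable_EFinP; apply: measurable_funM; first exact: measurableT_comp.
by apply/measurable_EFinP; exact: measurable_int ih.
Qed.

Let psi_ge0 y : 0 <= y -> y <= H t -> 0 <= psi y.
Proof. by move=> y0 yt; rewrite (le_trans psi0)// psi_nd. Qed.

Let g_ge0 r : 0 <= r <= t -> (0 <= (psi (H r) * h r)%:E)%E.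
Proof.
by move=> /andP[r0 rt]; rewrite lee_fin mulr_ge0// psi_ge0// H_nd.
Qed.

Let piece r s : 0 <= r -> r <= s -> s <= t ->
  (\int[mu]_(x in `]r, s]) (psi (H x) * h x)%:E <=
   (psi (H s) * (H s - H r))%:E)%E.
Proof.
move=> r0 rs st.
have sub : `]r, s] `<=` `[0, t].
  move=> x /=; rewrite !in_itv/= => /andP[rx xs].
  by rewrite (le_trans r0 (ltW rx)) (le_trans xs).
rewrite EFinM -H_diff// -ge0_integralZl_EFin//; last 3 first.
- by move=> x _; rewrite lee_fin.
- by apply: measurable_funS (measurable_int _ ih).
- by rewrite psi_ge0// H_nd// (le_trans r0).
apply: ge0_le_integral => //.
- by move=> x /sub; rewrite /= in_itv/=; exact: g_ge0.
- exact: measurable_funS mg.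
- apply: emeasurable_funM => //.
  by apply: measurable_funS (measurable_int _ ih).
- move=> x /= xrs; have := sub _ xrs; move: xrs.
  rewrite /= !in_itv/= => /andP[rx xs] /andP[x0 xt].
  rewrite -EFinM lee_fin ler_wpM2r// psi_nd//; first exact: H_nd.
  by apply: H_nd => //; exact: le_trans x0 xs.
Qed.

(** The change of variables y = H(r), for an integrable [h] that need not be
    continuous. For n + 1 levels y_k equally spaced in [0, H t], the
    intermediate value theorem cuts the time interval where [H] crosses the
    levels. On a piece where [H] runs from y_k to y_{k+1} the integral is at
    most psi(y_{k+1}) (y_{k+1} - y_k), which exceeds psi(y_k) (y_{k+1} - y_k)
    <= phi(y_{k+1}) - phi(y_k) by (psi(y_{k+1}) - psi(y_k)) H(t)/(n+1). Both
    bounds telescope, and the error is of order 1/n. *)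
Lemma integral_primitive_le :
  (\int[mu]_(r in `[0%R, t]) (psi (H r) * h r)%:E <= (phi (H t) - phi 0)%:E)%E.
Proof.
set Y := H t; have Y0 : 0 <= Y by exact: H_ge0.
(* The total error for levels at distance Y / (n + 1). *)
apply: (@le_add_eps _ _ _ ((psi Y - psi 0) * Y)) => n.
pose y (k : nat) := k%:R / n.+1%:R * Y.
have y_ge0 k : 0 <= y k by rewrite mulr_ge0// divr_ge0.
have yS k : y k.+1 = y k + Y / n.+1%:R.
  by rewrite /y -natr1 !mulrDl mul1r [_^-1 * Y]mulrC.
have y0 : y 0%N = 0 by rewrite /y mul0r mul0r.
have yN : y n.+1 = Y by rewrite /y divff// mul1r.
have y_le k : (k <= n.+1)%N -> y k <= Y.
  move=> kn; rewrite -[leRHS]mul1r ler_wpM2r// ler_pdivrMr// mul1r.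
  by rewrite ler_nat.
have psiy k : (k <= n.+1)%N -> 0 <= psi (y k) by move=> kn; rewrite psi_ge0// y_le.
have yk k : y k <= y k.+1 by rewrite yS lerDl divr_ge0.
have ySB k : y k.+1 - y k = Y / n.+1%:R by rewrite yS addrAC subrr add0r.
suff main k : (k <= n.+1)%N -> forall r, 0 <= r -> r <= t -> H r <= y k ->
    (\int[mu]_(x in `[0%R, r]) (psi (H x) * h x)%:E <=
     (phi (y k) - phi 0 + (psi (y k) - psi 0) * (Y / n.+1%:R))%:E)%E.
  have := main n.+1 (leqnn _) t t0 (lexx t).
  by rewrite yN mulrA; apply; exact: lexx.
elim: k => [_ r r_ge0 rt Hr|k IH kn r r_ge0 rt Hr].
  rewrite y0 !subrr mul0r addr0.
  have Hr0 : H r = 0 by apply/eqP; rewrite eq_le H_ge0 andbT -y0.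
  rewrite -(@integral_itv_obnd_cbnd _ _ (BRight r)).
    have := piece (lexx 0) r_ge0 rt.
    by rewrite H0 subr0 Hr0 mulr0.
  apply: measurable_funS mg => // x /=; rewrite !in_itv/= => /andP[x0 xr].
  by rewrite (ltW x0) (le_trans xr).
have phi_inc : psi (y k) * (Y / n.+1%:R) <= phi (y k.+1) - phi (y k).
  by rewrite -(ySB k); apply: psi_phi => //; exact: y_le.
have psi_inc : psi (y k) <= psi (y k.+1) by apply: psi_nd => //; exact: y_le.
have Yn0 : 0 <= Y / n.+1%:R by rewrite divr_ge0.
(* If [H r] is still below the previous level there is nothing to add;
   otherwise [s] is a time at which [H] crosses that level. *)
have [Hy|yH] := leP (H r) (y k).
  apply: (le_trans (IH (ltnW kn) r r_ge0 rt Hy)); rewrite lee_fin.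
  apply: lerD; last by rewrite ler_wpM2r// lerD2r.
  rewrite lerD2r -subr_ge0; apply: le_trans phi_inc.
  by rewrite mulr_ge0// psiy// ltnW.
have [s sr Hs] : exists2 s, s \in `[0, r] & H s = y k.
  apply: IVT => //.
    by apply: continuous_subspaceW cH; exact: itvS.
  by rewrite H0 min_l ?H_ge0// max_r ?H_ge0// y_ge0 ltW.
move: sr; rewrite in_itv/= => /andP[s0 sr].
have rE : `[0, r]%classic = `[0, s]%classic `|` `]s, r]%classic.
  by rewrite -itv_bndbnd_setU// bnd_simp.
have sub x : (`[0, s]%classic `|` `]s, r]%classic) x -> 0 <= x <= t.
  rewrite -rE /= in_itv/= => /andP[-> xr].
  exact: le_trans xr rt.
rewrite rE ge0_integral_setU//=; last 3 first.
- by apply: measurable_funS mg => // x /sub; rewrite /= in_itv.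
- by move=> x /sub; exact: g_ge0.
- rewrite disj_set2E; apply/eqP/seteqP; split => // x [] /=.
  by rewrite !in_itv/= => /andP[_ xs] /andP[/lt_le_trans/(_ xs)]; rewrite ltxx.
have Hsy : H s <= y k by rewrite Hs.
apply: le_trans (leeD (IH (ltnW kn) s s0 (le_trans sr rt) Hsy) (piece s0 sr rt)) _.
rewrite -EFinD lee_fin Hs.
have : psi (H r) * (H r - y k) <= psi (y k.+1) * (Y / n.+1%:R).
  apply: ler_pM.
  - by rewrite psi_ge0// H_nd.
  - by rewrite subr_ge0 ltW.
  - by apply: psi_nd => //; exact: y_le.
  - by rewrite -(ySB k) lerD2r.
move: phi_inc; rewrite !mulrBl.
set p1 := psi (y k) * _; set p2 := psi (y k.+1) * _.
set p3 := psi 0 * _; lra.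
Qed.

End integral_primitive.

Section riccati.
Context (R : realType) (Lambda b : R).
Hypotheses (L0 : 0 < Lambda) (b0 : 0 < b).

(** The solution of phi' = Lambda phi^{1+b}, phi(0) = 1, on the interval
    where Lambda b y < 1. *)
Definition riccati (y : R) : R := ((1 - Lambda * b * y) `^ b^-1)^-1.

Lemma riccati0 : riccati 0 = 1.
Proof. by rewrite /riccati mulr0 subr0 powR1 invr1. Qed.

Lemma riccati_gt0 y : Lambda * b * y < 1 -> 0 < riccati y.
Proof. by move=> y1; rewrite invr_gt0 powR_gt0// subr_gt0. Qed.

Lemma riccati_ge0 y : 0 <= riccati y.
Proof. by rewrite invr_ge0 powR_ge0. Qed.

Lemma le_riccati y z : y <= z -> Lambda * b * z < 1 -> riccati y <= riccati z.
Proof.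
move=> yz z1; have Lb0 : 0 < Lambda * b by rewrite mulr_gt0.
have yz' : Lambda * b * y <= Lambda * b * z by rewrite ler_pM2l.
have y1 := le_lt_trans yz' z1.
rewrite lef_pV2 ?posrE ?powR_gt0 ?subr_gt0//.
by rewrite ge0_ler_powR ?invr_ge0 ?nnegrE ?subr_ge0 ?(ltW b0) ?(ltW z1) ?(ltW y1)// lerB.
Qed.

Lemma riccati_powR y : Lambda * b * y < 1 ->
  riccati y `^ (1 + b) = riccati y / (1 - Lambda * b * y).
Proof.
move=> y1; have u0 : 0 < 1 - Lambda * b * y by rewrite subr_gt0.
rewrite powRD; last by rewrite (gt_eqF (riccati_gt0 y1)) implybT.
rewrite powRr1 ?riccati_ge0//; congr (_ * _).
rewrite /riccati -powRN -powRrM mulNr mulVf ?gt_eqF//.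
by rewrite powR_inv1// ltW.
Qed.

(** The tangent inequality for the convex function [riccati], whose
    derivative at [y] is Lambda riccati(y)^{1+b}. With s the ratio of 1 -
    Lambda b z to 1 - Lambda b y it reads (1 - s)/b <= s^{-1/b} - 1, which
    follows from e^x >= 1 + x and ln s <= s - 1. *)
Lemma riccati_convex y z : y <= z -> Lambda * b * z < 1 ->
  Lambda * riccati y `^ (1 + b) * (z - y) <= riccati z - riccati y.
Proof.
move=> yz z1; have Lb0 : 0 < Lambda * b by rewrite mulr_gt0.
have yz' : Lambda * b * y <= Lambda * b * z by rewrite ler_pM2l.
have y1 := le_lt_trans yz' z1.
rewrite riccati_powR//; set u := 1 - _; set v := 1 - Lambda * b * z.
have u0 : 0 < u by rewrite subr_gt0.
have v0 : 0 < v by rewrite subr_gt0.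
have zy : z - y = (u - v) / (Lambda * b).
  have -> : u - v = Lambda * b * (z - y) by rewrite /u /v; ring.
  by rewrite mulrC mulKf// gt_eqF.
have -> : riccati z = riccati y * (v / u) `^ (- b^-1).
  rewrite /riccati -/u -/v powRM ?invr_ge0 ?(ltW u0) ?(ltW v0)//.
  rewrite -(powR_inv1 (ltW u0)) -powRrM mulrNN mul1r powRN mulrCA mulVf ?mulr1//.
  by rewrite gt_eqF// powR_gt0.
have -> : Lambda * (riccati y / u) * (z - y) = riccati y * (b^-1 * (1 - v / u)).
  rewrite zy mulrBr mulr1 invfM.
  have Lne : Lambda != 0 by rewrite gt_eqF.
  have bne : b != 0 by rewrite gt_eqF.
  have une : u != 0 by rewrite gt_eqF.
  by field; rewrite une bne Lne.
rewrite -[X in _ <= _ - X]mulr1 -mulrBr ler_wpM2l ?riccati_ge0//.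
have w0 : 0 < v / u by rewrite divr_gt0.
rewrite /powR gt_eqF// lerBrDr addrC mulNr.
apply: le_trans (expR_ge1Dx _); rewrite lerD2l -mulrN ler_pM2l ?invr_gt0//.
have := @le_ln1Dx _ (v / u - 1); rewrite subrKC ltrBrDr addNr => /(_ w0) lnw.
by rewrite lerNr opprB.
Qed.

Lemma measurable_riccati_powR :
  measurable_fun setT (fun y => Lambda * riccati y `^ (1 + b)).
Proof.
have mr : measurable_fun setT (riccati : R -> R).
  rewrite (_ : riccati = (fun y => (1 - Lambda * b * y) `^ (- b^-1))); last first.
    by apply/funext => y; rewrite /riccati powRN.
  have ml : measurable_fun setT (fun y => 1 - Lambda * b * y : R).
    by apply: measurable_funB => //; exact: measurable_funM.
  exact: (measurableT_comp (measurable_powR (- b^-1)) ml).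
apply: measurable_funM => //.
exact: (measurableT_comp (measurable_powR (1 + b)) mr).
Qed.

End riccati.

(** * The nonlinearity and the damped heat flow *)

Section nonlinearity.
Context (R : realType) (G : R -> R).
Hypotheses (G_ge0 : forall z : R, 0 <= z -> 0 <= G z) (G_0 : G 0 = 0)
  (G_increasing : forall y z : R, 0 < y -> y <= z -> G y / y <= G z / z).

(** G(z) = z (G(z)/z) is a product of nonnegative nondecreasing functions. *)
Lemma le_nonlinearity y z : 0 <= y -> y <= z -> G y <= G z.
Proof.
rewrite le_eqVlt => /predU1P[<- z0|y0 yz]; first by rewrite G_0 G_ge0.
have z0 : 0 < z by exact: lt_le_trans yz.
rewrite -[G y](divfK (lt0r_neq0 y0)) -[G z](divfK (lt0r_neq0 z0)).
apply: ler_pM => //; last exact: G_increasing.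
- by rewrite divr_ge0 ?G_ge0// ltW.
- exact: ltW.
Qed.

(** Constant extension of [G] to the left of 0, which makes it monotone,
    hence measurable, on the whole line. *)
Definition nonlinearity (z : R) := G (Num.max 0 z).

Lemma measurable_nonlinearity : measurable_fun setT nonlinearity.
Proof.
apply: nondecreasing_measurable => // y z yz.
apply: le_nonlinearity; first by rewrite le_max lexx.
by rewrite ge_max le_max lexx/= le_max yz orbT.
Qed.

(** The local Lipschitz condition bears on pairs of points near (z, z);
    fixing the second point to be [z] gives continuity, also at the boundary
    point 0. *)
Lemma cvg_locally_lipschitz (u : nat -> R) (z : R) :
  [locally [lipschitz G z | z in `[0, +oo[]] ->
  (forall n, 0 <= u n) -> 0 <= z -> u n @[n --> \oo] --> z ->
  G (u n) @[n --> \oo] --> G z.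
Proof.
move=> Glip u0 z0 uz.
have zA : (`[0, +oo[ `*` `[0, +oo[)%classic (z, z) by split; rewrite /= in_itv/= andbT.
have [M [_ HM]] := Glip (z, z) zA.
have M0 : 0 < `|M| + 1 by rewrite ltr_wpDl.
have /HM : M < `|M| + 1 by rewrite (le_lt_trans (ler_norm M))// ltrDl.
rewrite /= /within/= => near_lip.
have uzz : (u n, z) @[n --> \oo] --> (z, z).
  exact: (cvg_pair uz (cvg_cst z)).
have lip_n : \forall n \near \oo, `|G (u n) - G z| <= (`|M| + 1) * `|u n - z|.
  have := uzz _ near_lip; rewrite !near_simpl => near_n.
  near=> n; suff : (fun t : R * R => `|G t.1 - G t.2| <= (`|M| + 1) * `|t.1 - t.2|) (u n, z) by [].
  have : `[0, +oo[%classic (u n) /\ `[0, +oo[%classic z.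
    by rewrite /= !in_itv/= !andbT.
  by near: n; exact: near_n.
apply/cvgrPdist_le => e e0.
have /cvgrPdist_le/(_ (e / (`|M| + 1)) (divr_gt0 e0 M0)) uze := uz.
near=> n.
rewrite distrC.
have : `|G (u n) - G z| <= (`|M| + 1) * `|u n - z|.
  by near: n.
move/le_trans; apply; rewrite mulrC -ler_pdivlMr// distrC.
by near: n.
Unshelve. all: by end_near. Qed.

End nonlinearity.

Section damped_heat.
Context (R : realType) (d : nat) (disp : measure_display)
  (T : measurableType disp) (P : probability T R) (B : R -> T -> 'rV[R]_d)
  (D : set 'rV[R]_d) (kappa : R) (f : 'rV[R]_d -> R).
Hypotheses (BM : brownian_motion_rV P B) (oD : open D)
  (f_ge0 : forall x, D x -> 0 <= f x) (cf : {in D, continuous f}).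

Local Notation killed_mean := (killed_mean P B D).
Let S := killed_semigroup P B D.
Local Notation damped := (damped S kappa f).
Local Notation decay t := (expR (- (kappa ^+ 2 * t / 2))).
Let fD : borel_rV R d -> \bar R := (EFin \o f) \_ D.

Lemma measurable_restrict_domain : measurable_fun setT fD.
Proof.
apply/(measurable_restrictT _ (measurable_open_rV oD)).
by apply/measurable_EFinP; exact: open_measurable_fun.
Qed.

Let fD_ge0 x : (0 <= fD x)%E.
Proof.
by rewrite /fD patchE; case: ifPn => // /set_mem Dx; rewrite lee_fin f_ge0.
Qed.

Lemma decayD s t : decay s * decay t = decay (s + t).
Proof. by rewrite -expRD; congr expR; rewrite mulrDr mulrDl opprD. Qed.

Lemma decay_le1 t : 0 <= t -> decay t <= 1.
Proof.
move=> t0; rewrite -[leRHS]expR0 ler_expR oppr_le0.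
by rewrite divr_ge0// mulr_ge0// sqr_ge0.
Qed.

Lemma damped_killed_mean t x : 0 <= t ->
  damped t x = ((decay t)%:E * killed_mean t fD x)%E.
Proof.
move=> t0; rewrite /Defs.damped /S killed_semigroupE//; congr (_ * _)%E.
apply: (eq_killed_mean BM oD) => // y Dy.
by rewrite /fD patchE mem_set.
Qed.

Lemma damped_ge0 t x : 0 <= t -> (0 <= damped t x)%E.
Proof.
move=> t0; rewrite damped_killed_mean// mule_ge0//.
exact: (killed_mean_ge0 BM oD).
Qed.

Lemma damped0 x : D x -> damped 0 x = (f x)%:E.
Proof.
move=> Dx; rewrite damped_killed_mean// mulr0 mul0r oppr0 expR0 mul1e.
by rewrite (killed_mean0 BM oD)// /fD patchE mem_set.
Qed.

Lemma measurable_damped : measurable_fun setT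
  (fun p : R * borel_rV R d => damped (Num.max 0 p.1) p.2).
Proof.
under eq_fun => p do rewrite damped_killed_mean ?le_max ?lexx//.
have mt : measurable_fun setT (fun p : R * borel_rV R d => Num.max 0 p.1).
  by apply: measurable_maxr.
apply: emeasurable_funM.
  apply/measurable_EFinP; apply: measurableT_comp => //.
  by apply: measurableT_comp => //; apply: measurable_funM => //; exact: measurable_funM.
apply: (@measurable_killed_mean _ _ _ _ _ _ _ BM oD _ (R * borel_rV R d)%type
  (fun p => Num.max 0 p.1) snd (fun q => fD q.2)) => //.
- by move=> p; rewrite le_max lexx.
- by apply: measurableT_comp => //; exact: measurable_restrict_domain.
Qed.

Lemma measurable_damped_at t : 0 <= t ->
  measurable_fun setT (fun x : borel_rV R d => damped t x).
Proof.
move=> t0; have := measurableT_comp measurable_damped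
  (pair1_measurable (T2 := borel_rV R d) t).
by apply: eq_measurable_fun => x _ /=; rewrite max_r.
Qed.

(** The Chapman-Kolmogorov identity, carrying the damping along. *)
Lemma damped_split a t x : 0 <= a -> a <= t ->
  ((decay (t - a))%:E * killed_mean (t - a) (damped a) x = damped t x)%E.
Proof.
move=> a0 at_; have t0 := le_trans a0 at_.
have mK : measurable_fun setT (killed_mean a fD).
  have := measurable_damped_at a0.
  move=> /(emeasurable_funM (measurable_cst (decay a)^-1%:E)).
  apply: eq_measurable_fun => y _ /=; rewrite damped_killed_mean// muleA -EFinM.
  by rewrite mulVf ?mul1e// gt_eqF// expR_gt0.
rewrite (_ : damped a = fun y => ((decay a)%:E * killed_mean a fD y)%E); last first.
  by apply/funext => y; rewrite damped_killed_mean.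
rewrite (killed_meanZ BM oD) ?subr_ge0 ?expR_ge0//; last first.
  by move=> y _; exact: (killed_mean_ge0 BM oD).
rewrite muleA -EFinM decayD subrK (killed_mean_semigroup BM oD) ?subr_ge0//.
  by rewrite subrK damped_killed_mean.
exact: measurable_restrict_domain.
Qed.

Lemma damped_le_sup_norm t x : 0 <= t -> D x -> (damped t x <= sup_norm D (damped t))%E.
Proof.
move=> t0 Dx; apply: ereal_sup_ubound; exists x => //.
by rewrite gee0_abs// damped_ge0.
Qed.

Lemma sup_norm_ge0 (g : 'rV[R]_d -> \bar R) : D !=set0 -> (0 <= sup_norm D g)%E.
Proof.
by case=> x Dx; apply: (@le_trans _ _ `|g x|%E) => //; apply: ereal_sup_ubound; exists x.
Qed.

(** Killed expectations and the damping factor are contractions for the sup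
    norm, so the sup norm of the damped flow can only decrease. *)
Lemma damped_le_earlier_sup_norm a t x : D !=set0 -> 0 <= a -> a <= t ->
  (damped t x <= sup_norm D (damped a))%E.
Proof.
move=> D0 a0 at_; rewrite -(damped_split _ a0 at_).
have s0 := sup_norm_ge0 (damped a) D0.
apply: (@le_trans _ _ ((decay (t - a))%:E * sup_norm D (damped a))%E).
  apply: lee_wpmul2l; first by rewrite lee_fin expR_ge0.
  apply: (killed_mean_le_sup BM oD) => //.
  - by rewrite subr_ge0.
  - exact: measurable_damped_at.
  - by move=> y _; exact: damped_ge0.
  - by move=> y; exact: damped_le_sup_norm.
rewrite -[leRHS]mul1e; apply: lee_wpmul2r => //.
by rewrite lee_fin decay_le1// subr_ge0.
Qed.

Lemma sup_norm_damped_nonincreasing a t : D !=set0 -> 0 <= a -> a <= t ->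
  (sup_norm D (damped t) <= sup_norm D (damped a))%E.
Proof.
move=> D0 a0 at_; apply: ge_ereal_sup => _ [x Dx <-].
rewrite gee0_abs ?damped_ge0 ?(le_trans a0)//.
exact: damped_le_earlier_sup_norm.
Qed.

End damped_heat.

(** * The weight and the amplification factor *)

(** Preimages of the rays [c, +oo] are intervals. *)
Lemma nonincreasing_emeasurable (R : realType) (I : interval R) (f : R -> \bar R) :
  {in I &, forall s t, s <= t -> (f t <= f s)%E} ->
  measurable_fun [set` I] f.
Proof.
move=> nif; apply: (@measurability _ _ _ _ _ _ (@ErealGenCInfty.G R)).
  exact: ErealGenCInfty.measurableE.
move=> _ [_ [c ->] <-]; apply: is_interval_measurable.
move=> s t [Is _] [It ft] u /andP[su ut].
have Iu : [set` I] u by apply: (@interval_is_interval R I s t Is It u); rewrite su.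
have {}ft : (c%:E <= f t)%E by move: ft; rewrite /= in_itv/= andbT.
split => //=; rewrite in_itv/= andbT (le_trans ft)//.
exact: nif.
Qed.

Section weighted_integral.
Context (R : realType) (d : nat) (disp : measure_display)
  (T : measurableType disp) (P : probability T R) (B : R -> T -> 'rV[R]_d)
  (D : set 'rV[R]_d) (kappa : R) (f : 'rV[R]_d -> R)
  (Lambda beta : R) (w : R -> R).
Hypotheses (BM : brownian_motion_rV P B) (oD : open D) (D0 : D !=set0)
  (f_ge0 : forall x, D x -> 0 <= f x) (cf : {in D, continuous f})
  (L0 : 0 < Lambda) (beta0 : 0 < beta)
  (cw : {within `[0, +oo[, continuous w}).

Notation mu := (@lebesgue_measure R).
Let S := killed_semigroup P B D.
Local Notation damped := (damped S kappa f).
Local Notation M r := (sup_norm D (damped r)).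
Let J := weighted_integral D S kappa beta w f.
Let h (r : R) : \bar R := ((expR (kappa * beta * w r))%:E * M r `^ beta)%E.

Hypothesis Jlt1 : ((Lambda * beta)%:E * J `[0%R, +oo[%classic < 1)%E.

Let Lb0 : 0 < Lambda * beta. Proof. by rewrite mulr_gt0. Qed.

Let h_ge0 r : (0 <= h r)%E.
Proof. by rewrite mule_ge0 ?lee_fin ?expR_ge0 ?poweR_ge0. Qed.

Let mw : measurable_fun (`[0, +oo[%classic : set R) w.
Proof. by apply: subspace_continuous_measurable_fun. Qed.

Let mh : measurable_fun (`[0, +oo[%classic : set R) h.
Proof.
apply: emeasurable_funM.
  apply/measurable_EFinP; apply: measurableT_comp => //.
  by apply: measurable_funM.
apply: (measurableT_comp (measurable_poweR beta)).
apply: nonincreasing_emeasurable => s t; rewrite !in_itv/= !andbT => s0 t0 st.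
exact: (sup_norm_damped_nonincreasing kappa BM oD f_ge0 cf).
Qed.

Let subT (t : R) : `[0, t]%classic `<=` `[0, +oo[%classic.
Proof. by move=> r /=; rewrite !in_itv/= andbT => /andP[]. Qed.

Let J_le t : (J `[0%R, t]%classic <= J `[0%R, +oo[%classic)%E.
Proof.
by apply: (@ge0_subset_integral _ _ _ mu `[0, t] `[0, +oo[ _ _ h).
Qed.

Lemma weighted_integral_fin_num t : J `[0%R, t]%classic \is a fin_num.
Proof.
have J0 I : (0 <= J I)%E by apply: integral_ge0 => r _; exact: h_ge0.
rewrite ge0_fin_numE//; apply: (le_lt_trans (J_le t)).
rewrite ltey; apply/eqP => Joo; move: Jlt1.
by rewrite Joo gt0_muley ?lte_fin// ltNge leey.
Qed.

Lemma weighted_integral_lt1 t : Lambda * beta * fine (J `[0%R, t]%classic) < 1.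
Proof.
rewrite -lte_fin EFinM fineK ?weighted_integral_fin_num//.
apply: le_lt_trans Jlt1; apply: lee_wpmul2l => //.
by rewrite lee_fin ltW.
Qed.

(** As the sup norm is nonincreasing, an infinite value at time r would make
    the weight infinite on the whole of [0, r]. *)
Lemma sup_norm_damped_fin_num r : 0 < r -> M r \is a fin_num.
Proof.
move=> r0; rewrite ge0_fin_numE ?sup_norm_ge0// ltey; apply/eqP => Moo.
have := weighted_integral_fin_num r.
suff -> : J `[0%R, r]%classic = +oo%E by [].
rewrite /J /weighted_integral.
rewrite (eq_integral (cst +oo%E)).
  rewrite integral_cst//= lebesgue_measure_itv/= lte_fin r0 sube0.
  by rewrite gt0_mulye// lte_fin.
move=> s; rewrite inE/= in_itv/= => /andP[s0 sr].
have -> : M s = +oo%E.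
  apply/eqP; rewrite -leye_eq -Moo.
  exact: (sup_norm_damped_nonincreasing kappa BM oD f_ge0 cf).
by rewrite poweRyr ?gt_eqF// gt0_muley// lte_fin expR_gt0.
Qed.

(** At positive times the sup norm is finite; at time 0 the damped flow is
    [f] itself, which is finite though possibly unbounded. *)
Lemma damped_fin_num t x : 0 <= t -> D x -> damped t x \is a fin_num.
Proof.
rewrite le_eqVlt => /predU1P[<- Dx|t0 Dx].
  by rewrite (damped0 kappa f BM oD)//.
have td := ltW t0.
rewrite ge0_fin_numE ?(damped_ge0 kappa BM oD)//.
apply: (le_lt_trans (damped_le_sup_norm kappa BM oD f_ge0 td Dx)).
by rewrite -ge0_fin_numE ?sup_norm_ge0// sup_norm_damped_fin_num.
Qed.

(** A real version of the weight.  Among nonnegative times it may differ from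
    the extended one at time 0 only, where the sup norm of [f] need not be
    finite. *)
Definition weight (r : R) : R := fine (h r).

Lemma weight_ge0 r : 0 <= weight r.
Proof. by rewrite fine_ge0. Qed.

Lemma weightE r : 0 < r -> weight r = expR (kappa * beta * w r) * fine (M r) `^ beta.
Proof.
move=> r0; rewrite /weight /h fineM ?fine_poweR//.
by rewrite fin_num_poweR// sup_norm_damped_fin_num.
Qed.

Let weight_fineK r : 0 < r -> (weight r)%:E = h r.
Proof.
move=> r0; rewrite /weight fineK// fin_numM//.
by rewrite fin_num_poweR// sup_norm_damped_fin_num.
Qed.

Let mweight (t : R) : measurable_fun `[0, t] weight.
Proof.
apply: (measurableT_comp (fine_measurable measurableT)).
exact: measurable_funS mh.
Qed.

Let integral_weight (t : R) :
  (\int[mu]_(r in `[0%R, t]) (weight r)%:E = J `[0%R, t]%classic)%E.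
Proof.
have sub : `]0, t]%classic `<=` `[0, t]%classic.
  by move=> r /=; rewrite !in_itv/= => /andP[/ltW -> ->].
rewrite -(@integral_itv_obnd_cbnd _ _ (BRight t)); last first.
  by apply/measurable_EFinP; apply: (measurable_funS _ sub (@mweight t)).
rewrite /J /weighted_integral -(@integral_itv_obnd_cbnd _ _ (BRight t)); last first.
  by apply: (measurable_funS _ _ mh) => //; exact: (subset_trans sub (@subT t)).
by apply: eq_integral => r; rewrite inE/= in_itv/= => /andP[r0 _]; rewrite weight_fineK.
Qed.

Lemma integrable_weight (t : R) : mu.-integrable `[0, t] (EFin \o weight).
Proof.
apply/integrableP; split; first by apply/measurable_EFinP; exact: mweight.
under eq_integral => r _ do rewrite /= ger0_norm ?weight_ge0//.
by rewrite integral_weight ltey_eq weighted_integral_fin_num.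
Qed.

Lemma fine_weighted_integral (t : R) :
  fine (J `[0%R, t]%classic) = (\int[mu]_(r in `[0, t]) weight r)%R.
Proof. by rewrite /Rintegral integral_weight. Qed.

(** The factor by which the solution may exceed the damped linear flow. *)
Definition amplification (t : R) : R :=
  riccati Lambda beta (fine (J `[0%R, t]%classic)).

Lemma amplification_ge0 t : 0 <= amplification t.
Proof. exact: riccati_ge0. Qed.

(** Formally, the integrand on the left is the derivative of the
    amplification factor, whose value at time 0 is 1. *)
Lemma integral_amplification_le (t : R) : 0 <= t ->
  (\int[mu]_(r in `[0%R, t]) (Lambda * amplification r `^ (1 + beta) * weight r)%:E
   <= (amplification t - 1)%:E)%E.
Proof.
move=> t0; pose psi y := Lambda * riccati Lambda beta y `^ (1 + beta).
have Jlt y : y <= fine (J `[0%R, t]%classic) -> Lambda * beta * y < 1.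
  by move=> yJ; apply: le_lt_trans (weighted_integral_lt1 t); rewrite ler_pM2l.
have -> : (\int[mu]_(r in `[0%R, t])
      (Lambda * amplification r `^ (1 + beta) * weight r)%:E =
    \int[mu]_(r in `[0%R, t])
      (psi (\int[mu]_(x in `[0%R, r]) weight x)%R * weight r)%:E)%E.
  by apply: eq_integral => r _; rewrite /psi /amplification fine_weighted_integral.
rewrite /amplification -[X in (_ - X)%:E](riccati0 Lambda beta).
rewrite fine_weighted_integral in Jlt *.
apply: (@integral_primitive_le R weight t (riccati Lambda beta) psi t0 weight_ge0
  (integrable_weight t) (measurable_riccati_powR Lambda beta)).
- by rewrite mulr_ge0 ?powR_ge0// ltW.
- move=> y z _ yz zJ; apply: ler_wpM2l; first exact: ltW.
  apply: ge0_ler_powR; [by rewrite addr_ge0// ltW|exact: riccati_ge0..|].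
  by apply: le_riccati => //; exact: Jlt.
- by move=> y z y0 yz zJ; apply: riccati_convex => //; exact: Jlt.
Qed.

Lemma amplification_powR_ge0 r : 0 <= Lambda * amplification r `^ (1 + beta) * weight r.
Proof. by rewrite !mulr_ge0 ?powR_ge0 ?weight_ge0// ltW. Qed.

Lemma measurable_amplification_weight (t : R) : 0 <= t ->
  measurable_fun `[0, t] (fun r => Lambda * amplification r `^ (1 + beta) * weight r).
Proof.
move=> t0; apply: measurable_funM => //.
have mJ : measurable_fun `[0, t] (fun r => fine (J `[0%R, r]%classic)).
  rewrite (_ : (fun r => _) = (fun r => (\int[mu]_(x in `[0%R, r]) weight x)%R)).
    2: by apply/funext => r; exact: fine_weighted_integral.
  apply: subspace_continuous_measurable_fun => //.
  exact: (parameterized_integral_continuous t0 (integrable_weight t)).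
exact: (measurableT_comp (measurable_riccati_powR Lambda beta) mJ).
Qed.

End weighted_integral.

(** * Picard iteration *)

Section picard.
Context (R : realType) (d : nat) (disp : measure_display)
  (T : measurableType disp) (P : probability T R) (B : R -> T -> 'rV[R]_d)
  (D : set 'rV[R]_d) (kappa : R) (f : 'rV[R]_d -> R)
  (Lambda beta : R) (w : R -> R) (G : R -> R).
Hypotheses (BM : brownian_motion_rV P B) (oD : open D) (D0 : D !=set0)
  (f_ge0 : forall x, D x -> 0 <= f x) (cf : {in D, continuous f})
  (L0 : 0 < Lambda) (beta0 : 0 < beta)
  (cw : {within `[0, +oo[, continuous w}).
Hypotheses (G_ge0 : forall z : R, 0 <= z -> 0 <= G z)
  (G_loc_lipschitz : [locally [lipschitz G z | z in `[0, +oo[]])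
  (G_0 : G 0 = 0)
  (G_increasing : forall y z : R, 0 < y -> y <= z -> G y / y <= G z / z)
  (G_le : forall z : R, 0 < z -> G z <= Lambda * z `^ (1 + beta)).

Notation mu := (@lebesgue_measure R).
Let S := killed_semigroup P B D.
Local Notation damped := (damped S kappa f).
Local Notation decay t := (expR (- (kappa ^+ 2 * t / 2))).
Local Notation killed_mean := (killed_mean P B D).
Local Notation ampl := (amplification P B D kappa f Lambda beta w).
Local Notation weight := (weight P B D kappa f beta w).

Hypothesis Jlt1 : ((Lambda * beta)%:E *
  weighted_integral D S kappa beta w f `[0%R, +oo[%classic < 1)%E.

Local Notation V := (borel_rV R d).
Implicit Types (v : R * V -> R) (p : R * V).

(** The reaction term of the mild equation, set to 0 outside [D] and frozen
    at negative times so as to be measurable on the whole space. *)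
Definition source v : R * V -> R :=
  (fun p => expR (- (kappa * w (Num.max 0 p.1))) *
    nonlinearity G (expR (kappa * w (Num.max 0 p.1)) * v p)) \_ (setT `*` D).

Lemma sourceE v r y : 0 <= r -> D y -> 0 <= v (r, y) ->
  source v (r, y) = expR (- (kappa * w r)) * G (expR (kappa * w r) * v (r, y)).
Proof.
move=> r0 Dy v0; rewrite /source patchE mem_set//= /nonlinearity.
by rewrite (max_r r0) max_r// mulr_ge0// expR_ge0.
Qed.

Lemma source_ge0 v p : 0 <= source v p.
Proof.
rewrite /source patchE; case: ifP => // _.
by rewrite mulr_ge0 ?expR_ge0// G_ge0// le_max lexx.
Qed.

Lemma le_source v v' p : v p <= v' p -> source v p <= source v' p.
Proof.
move=> vv; rewrite /source !patchE; case: ifP => // _.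
rewrite ler_wpM2l ?expR_ge0//; apply: (le_nonlinearity G_ge0 G_0 G_increasing).
  by rewrite le_max lexx.
by rewrite ge_max le_max lexx/= le_max ler_wpM2l ?orbT// expR_ge0.
Qed.

Let measurable_max0 (h : R -> R) : {within `[0, +oo[, continuous h} ->
  measurable_fun setT (fun r : R => h (Num.max 0 r)).
Proof. by move=> /continuous_comp_max0; exact: continuous_measurable_fun. Qed.

Lemma measurable_source v : measurable_fun setT v -> measurable_fun setT (source v).
Proof.
move=> mv.
have mD : measurable (setT `*` D : set (R * V)).
  by apply: measurableX => //; exact: measurable_open_rV.
apply/(measurable_restrictT _ mD); apply: measurable_funTS.
have mw1 : measurable_fun setT (fun p : R * V => kappa * w (Num.max 0 p.1)).
  apply: measurable_funM => //.
  exact: (measurableT_comp (measurable_max0 cw) measurable_fst).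
apply: measurable_funM.
  by apply: measurableT_comp => //; exact: measurableT_comp.
apply: (measurableT_comp (measurable_nonlinearity G_ge0 G_0 G_increasing)).
by apply: measurable_funM => //; exact: measurableT_comp.
Qed.

Lemma cvg_source (v : nat -> R * V -> R) v' p :
  (forall n, 0 <= v n p) -> 0 <= v' p -> v n p @[n --> \oo] --> v' p ->
  source (v n) p @[n --> \oo] --> source v' p.
Proof.
move=> v0 v'0 cv; rewrite /source patchE.
under eq_fun do rewrite patchE.
case: ifP => _; last exact: cvg_cst.
apply: cvgMr; rewrite /nonlinearity.
set e := expR _; have e0 : 0 <= e by exact: expR_ge0.
rewrite (max_r (mulr_ge0 e0 v'0)).
under eq_fun do rewrite (max_r (mulr_ge0 e0 (v0 _))).
apply: (cvg_locally_lipschitz (u := fun n => e * v n p)) => //.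
- by move=> n; rewrite mulr_ge0.
- by rewrite mulr_ge0.
- exact: cvgMr.
Qed.

(** Of the factors e^{-kappa W} and e^{kappa (1 + beta) W} there remains
    e^{kappa beta W}. *)
Lemma source_le v r y z : 0 <= r -> D y -> 0 <= z -> v (r, y) <= z ->
  source v (r, y) <= Lambda * expR (kappa * beta * w r) * z `^ (1 + beta).
Proof.
move=> r0 Dy z0 vz.
apply: (@le_trans _ _ (source (cst z) (r, y))); first exact: le_source.
rewrite sourceE//=; move: z0; rewrite le_eqVlt => /predU1P[<-|z0].
  by rewrite mulr0 G_0 mulr0 !mulr_ge0 ?expR_ge0 ?powR_ge0// ltW.
set e := expR (kappa * w r); have e0 : 0 < e by exact: expR_gt0.
apply: (@le_trans _ _ (e^-1 * (Lambda * (e * z) `^ (1 + beta)))).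
  by rewrite -expRN ler_wpM2l ?expR_ge0// G_le// mulr_gt0.
have ene : e != 0 by rewrite gt_eqF.
rewrite powRM ?(ltW e0) ?(ltW z0)// (@powRD _ e); last by rewrite ene implybT.
rewrite powRr1 ?(ltW e0)//.
have -> : e `^ beta = expR (kappa * beta * w r) by rewrite /e -expRM mulrAC.
rewrite le_eqVlt; apply/orP; left; apply/eqP; by field.
Qed.

Definition duhamel v (p : R * V) (r : R) : \bar R :=
  ((decay (Num.max 0%R (p.1 - r)%R))%:E *
   killed_mean (Num.max 0%R (p.1 - r)%R) (fun y => (source v (r, y))%:E) p.2)%E.

Lemma duhamel_ge0 v p r : (0 <= duhamel v p r)%E.
Proof.
rewrite mule_ge0 ?lee_fin ?expR_ge0//.
apply: (killed_mean_ge0 BM oD); first by rewrite le_max lexx.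
by move=> y _; rewrite lee_fin source_ge0.
Qed.

Lemma measurable_duhamel v : measurable_fun setT v ->
  measurable_fun setT (fun q : (R * V) * R => duhamel v q.1 q.2).
Proof.
move=> mv.
have mt : measurable_fun setT (fun q : (R * V) * R => Num.max 0 (q.1.1 - q.2)).
  apply: measurable_maxr => //; apply: measurable_funB => //.
  exact: (measurableT_comp measurable_fst measurable_fst).
apply: emeasurable_funM.
  apply/measurable_EFinP; apply: measurableT_comp => //.
  by apply: measurableT_comp => //; apply: measurable_funM => //; exact: measurable_funM.
apply: (@measurable_killed_mean _ _ _ _ _ _ _ BM oD _ ((R * V) * R)%type
  (fun q => Num.max 0 (q.1.1 - q.2)) (fun q => q.1.2)
  (fun u => (source v (u.1.2, u.2))%:E)) => //.
- by move=> q; rewrite le_max lexx.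
- exact: (measurableT_comp measurable_snd measurable_fst).
- apply/measurable_EFinP; apply: (measurableT_comp (measurable_source mv)).
  apply: measurable_fun_pair => //.
  exact: (measurableT_comp measurable_snd measurable_fst).
- by move=> u; rewrite lee_fin source_ge0.
Qed.

Lemma measurable_duhamel_time v p (I : set R) : measurable_fun setT v ->
  measurable_fun I (duhamel v p).
Proof.
move=> mv; apply: measurable_funTS.
exact: (measurableT_comp (measurable_duhamel mv) (pair1_measurable p)).
Qed.

Definition mild_map v p : \bar R :=
  (damped (Num.max 0%R p.1) p.2 + \int[mu]_(r in `[0%R, p.1]) duhamel v p r)%E.

Lemma measurable_mild_map v : measurable_fun setT v ->
  measurable_fun setT (mild_map v).
Proof.
move=> mv; apply: emeasurable_funD.
  exact: (measurable_damped kappa BM oD f_ge0 cf).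
pose g (q : (R * V) * R) := duhamel v q.1 q.2.
pose E : set ((R * V) * R) := [set q | 0 <= q.2 <= q.1.1].
have mE : measurable E.
  have -> : E = (fun q => q.2) @^-1` `[0, +oo[ `&` (fun q => q.1.1 - q.2) @^-1` `[0, +oo[.
    apply/seteqP; split => q /=; rewrite /E/= !in_itv/= !andbT subr_ge0.
      by move=> /andP[].
    by move=> [-> ->].
  apply: measurableI; rewrite -[X in measurable X]setTI.
    exact: measurable_snd.
  have : measurable_fun setT (fun q : (R * V) * R => q.1.1 - q.2).
    apply: measurable_funB => //.
    exact: (measurableT_comp measurable_fst measurable_fst).
  by apply.
have mg : measurable_fun setT (g \_ E).
  apply/(measurable_restrictT g mE); apply: measurable_funTS.
  exact: measurable_duhamel.
have g0 q : (0 <= (g \_ E) q)%E.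
  by rewrite patchE; case: ifP => // _; exact: duhamel_ge0.
have := @measurable_fun_fubini_tonelli_F _ _ _ _ _ mu (g \_ E) mg g0.
apply: eq_measurable_fun => p _; rewrite /fubini_F [RHS]integral_mkcond.
apply: eq_integral => r _; rewrite !patchE.
have -> // : ((p, r) \in E) = (r \in `[0, p.1]%classic).
by apply/idP/idP => /set_mem H; apply/mem_set; move: H; rewrite /E/= in_itv.
Qed.

Let dominated v := forall r y, 0 <= r -> D y ->
  ((v (r, y))%:E <= (ampl r)%:E * damped r y)%E.

(** The pointwise domination of [v] costs one factor damped^beta, bounded by
    its supremum and absorbed in the weight; the remaining factor [damped r]
    is carried by the semigroup from time [r] to time [t]. *)
Lemma duhamel_le v t x r : measurable_fun setT v -> dominated v ->
  D x -> 0 < r -> r <= t ->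
  (duhamel v (t, x) r <=
   (Lambda * ampl r `^ (1 + beta) * weight r)%:E * damped t x)%E.
Proof.
move=> mv dom Dx r0 rt; have r_ge0 := ltW r0.
have tr0 : 0 <= t - r by rewrite subr_ge0.
set C := Lambda * _ * _.
have C0 : 0 <= C by exact: (amplification_powR_ge0 _ _ _ _ _ _ _ L0).
rewrite /duhamel/= (max_r tr0) -(damped_split kappa BM oD f_ge0 cf _ r_ge0 rt).
rewrite muleCA; apply: lee_wpmul2l; first by rewrite lee_fin expR_ge0.
have md := measurable_damped_at kappa BM oD f_ge0 cf r_ge0.
have d0 y : (0 <= damped r y)%E by exact: (damped_ge0 kappa BM oD f_ge0).
rewrite -(killed_meanZ BM oD)//.
apply: (le_killed_mean BM oD) => //.
- apply/measurable_EFinP; apply: (measurableT_comp (measurable_source mv)).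
  exact: pair1_measurable.
- exact: emeasurable_funM.
- by move=> y _; rewrite lee_fin source_ge0.
move=> y Dy.
have dfin := damped_fin_num BM oD D0 f_ge0 cf L0 beta0 cw Jlt1 r_ge0 Dy.
set z := fine (damped r y); have zE : damped r y = z%:E by rewrite fineK.
have z0 : 0 <= z by rewrite fine_ge0.
rewrite zE -EFinM lee_fin.
have a0 : 0 <= ampl r by exact: amplification_ge0.
have vz : v (r, y) <= ampl r * z.
  by have := dom r y r_ge0 Dy; rewrite zE -EFinM lee_fin.
apply: (le_trans (source_le r_ge0 Dy (mulr_ge0 a0 z0) vz)).
rewrite powRM// /C (weightE BM oD D0 f_ge0 cf L0 beta0 cw Jlt1 r0).
set M := fine (sup_norm D (damped r)).
have Mfin := sup_norm_damped_fin_num BM oD D0 f_ge0 cf L0 beta0 cw Jlt1 r0.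
have zM : z <= M.
  by rewrite fine_le//; exact: (damped_le_sup_norm kappa BM oD f_ge0).
have zpow : z `^ (1 + beta) <= M `^ beta * z.
  have [->|z_neq0] := eqVneq z 0.
    by rewrite powR0 ?mulr0// gt_eqF// addr_gt0.
  rewrite powRD; last by rewrite z_neq0 implybT.
  rewrite powRr1// mulrC ler_wpM2r// ge0_ler_powR ?nnegrE ?(ltW beta0)//.
  exact: le_trans zM.
rewrite [leLHS](_ : _ = Lambda * ampl r `^ (1 + beta) * expR (kappa * beta * w r) *
  z `^ (1 + beta)); last by ring.
rewrite [leRHS](_ : _ = Lambda * ampl r `^ (1 + beta) * expR (kappa * beta * w r) *
  (M `^ beta * z)); last by ring.
by apply: ler_wpM2l => //; rewrite !mulr_ge0 ?expR_ge0 ?powR_ge0// ltW.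
Qed.

Lemma mild_map_le v t x : measurable_fun setT v -> dominated v ->
  0 <= t -> D x -> (mild_map v (t, x) <= (ampl t)%:E * damped t x)%E.
Proof.
move=> mv dom t0 Dx; rewrite /mild_map/= (max_r t0).
have d0 := damped_ge0 kappa BM oD f_ge0 x t0.
have dfin := damped_fin_num BM oD D0 f_ge0 cf L0 beta0 cw Jlt1 t0 Dx.
set C := fun r => Lambda * ampl r `^ (1 + beta) * weight r.
have C0 r : 0 <= C r by exact: (amplification_powR_ge0 _ _ _ _ _ _ _ L0).
have mC : measurable_fun `[0, t] C.
  exact: (measurable_amplification_weight BM oD D0 f_ge0 cf L0 beta0 cw Jlt1 t0).
have sub : `]0, t]%classic `<=` `[0, t]%classic.
  by move=> r /=; rewrite !in_itv/= => /andP[/ltW -> ->].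
have : (\int[mu]_(r in `[0%R, t]) duhamel v (t, x) r <= (ampl t - 1)%:E * damped t x)%E.
  rewrite -(@integral_itv_obnd_cbnd _ _ (BRight t)); last exact: measurable_duhamel_time.
  apply: (@le_trans _ _ (\int[mu]_(r in `]0%R, t]) ((C r)%:E * damped t x))%E).
    apply: ge0_le_integral => //.
    - by move=> r _; exact: duhamel_ge0.
    - exact: measurable_duhamel_time.
    - apply: emeasurable_funM => //.
      by apply/measurable_EFinP; exact: (measurable_funS _ sub mC).
    - by move=> r /=; rewrite in_itv/= => /andP[r0 rt]; exact: duhamel_le.
  rewrite integral_itv_obnd_cbnd; last first.
    apply: emeasurable_funM => //.
    by apply/measurable_EFinP; exact: (measurable_funS _ sub mC).
  rewrite -(fineK dfin) ge0_integralZr//=; last 3 first.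
  - by apply/measurable_EFinP.
  - by move=> r _; rewrite lee_fin.
  - by rewrite lee_fin fine_ge0.
  apply: lee_wpmul2r; first by rewrite lee_fin fine_ge0.
  exact: (integral_amplification_le BM oD D0 f_ge0 cf L0 beta0 cw Jlt1 t0).
rewrite -(fineK dfin) -EFinM => /(leeD2l (fine (damped t x))%:E) /le_trans; apply.
by rewrite -EFinD -EFinM lee_fin mulrBl mul1r subrKC.
Qed.

Lemma le_duhamel v v' p r : measurable_fun setT v -> measurable_fun setT v' ->
  (forall q, v q <= v' q) -> (duhamel v p r <= duhamel v' p r)%E.
Proof.
move=> mv mv' vv; apply: lee_wpmul2l; first by rewrite lee_fin expR_ge0.
have ms u : measurable_fun setT u ->
    measurable_fun setT (fun y : V => (source u (r, y))%:E).
  move=> mu_; apply/measurable_EFinP; apply: (measurableT_comp (measurable_source mu_)).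
  exact: pair1_measurable.
apply: (le_killed_mean BM oD); rewrite ?le_max ?lexx//.
- exact: ms.
- exact: ms.
- by move=> y _; rewrite lee_fin source_ge0.
- by move=> y _; rewrite lee_fin le_source.
Qed.

Lemma le_mild_map v v' p : measurable_fun setT v -> measurable_fun setT v' ->
  (forall q, v q <= v' q) -> (mild_map v p <= mild_map v' p)%E.
Proof.
move=> mv mv' vv; apply: leeD2l; apply: ge0_le_integral => //.
- by move=> r _; exact: duhamel_ge0.
- exact: measurable_duhamel_time.
- exact: measurable_duhamel_time.
- by move=> r _; exact: le_duhamel.
Qed.

Lemma mild_map_ge0 v p : (0 <= mild_map v p)%E.
Proof.
apply: adde_ge0; first by apply: (damped_ge0 kappa BM oD f_ge0); rewrite le_max lexx.
by apply: integral_ge0 => r _; exact: duhamel_ge0.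
Qed.

(** Monotone convergence in the killed expectation and then in time. *)
Lemma cvg_mild_map (v : nat -> R * V -> R) v' p :
  (forall n, measurable_fun setT (v n)) -> (forall n q, 0 <= v n q) ->
  (forall n q, v n q <= v n.+1 q) -> (forall q, 0 <= v' q) ->
  (forall q, v n q @[n --> \oo] --> v' q) ->
  mild_map (v n) p @[n --> \oo] --> mild_map v' p.
Proof.
move=> mv v0 vS v'0 cv.
have ms n r : measurable_fun setT (fun y : V => (source (v n) (r, y))%:E).
  apply/measurable_EFinP; apply: (measurableT_comp (measurable_source (mv n))).
  exact: pair1_measurable.
have cd r : duhamel (v n) p r @[n --> \oo] --> duhamel v' p r.
  apply: cvgeMl => //.
  apply: (cvg_killed_mean BM oD (g := fun n y => (source (v n) (r, y))%:E)).
  - by rewrite le_max lexx.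
  - by move=> n; exact: ms.
  - by move=> n y _; rewrite lee_fin source_ge0.
  - move=> y _; apply/nondecreasing_seqP => n.
    by rewrite lee_fin le_source.
  - by move=> y _; apply: cvg_EFin; [exact: nearW|exact: cvg_source].
apply: cvgeD.
- apply: ge0_adde_def; rewrite inE.
    by apply: (damped_ge0 kappa BM oD f_ge0); rewrite le_max lexx.
  by apply: integral_ge0 => r _; exact: duhamel_ge0.
- exact: cvg_cst.
have -> : (\int[mu]_(r in `[0%R, p.1]) duhamel v' p r =
    \int[mu]_(r in `[0%R, p.1]) limn (fun n => duhamel (v n) p r))%E.
  by apply: eq_integral => r _; apply/esym/cvg_lim => //; exact: cd.
apply: (@cvg_monotone_convergence _ _ _ mu _ _ (fun n => duhamel (v n) p)) => //.
- by move=> n; exact: measurable_duhamel_time.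
- by move=> n r _; exact: duhamel_ge0.
- move=> r _; apply/nondecreasing_seqP => n.
  by apply: le_duhamel => // q; exact: vS.
Qed.

Let domain : set (R * V) := [set t : R | 0 <= t] `*` D.

Fixpoint picard (n : nat) : R * V -> R :=
  if n is m.+1 then (fine \o mild_map (picard m)) \_ domain else cst 0.

Lemma measurable_picard n : measurable_fun setT (picard n).
Proof.
elim: n => [|n IH] /=; first exact: measurable_cst.
have mD : measurable domain.
  apply: measurableX; last exact: measurable_open_rV.
  rewrite (_ : [set t | _] = `[0, +oo[%classic); first exact: measurable_itv.
  by apply/seteqP; split => t /=; rewrite in_itv/= andbT.
apply/(measurable_restrictT _ mD); apply: measurable_funTS.
apply: (measurableT_comp (fine_measurable measurableT)).
exact: measurable_mild_map.
Qed.

Lemma picard_ge0 n p : 0 <= picard n p.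
Proof.
case: n => [|n] //=; rewrite patchE; case: ifP => // _.
by rewrite fine_ge0// mild_map_ge0.
Qed.

Let picard_mild n t x : dominated (picard n) -> 0 <= t -> D x ->
  (picard n.+1 (t, x))%:E = mild_map (picard n) (t, x).
Proof.
move=> dom t0 Dx; rewrite /= patchE mem_set//= fineK//.
rewrite ge0_fin_numE ?mild_map_ge0//.
apply: (le_lt_trans (mild_map_le (measurable_picard n) dom t0 Dx)).
have dfin := damped_fin_num BM oD D0 f_ge0 cf L0 beta0 cw Jlt1 t0 Dx.
by rewrite -(fineK dfin) -EFinM ltry.
Qed.

(** The induction step is the invariance of the domination under [mild_map]. *)
Lemma picard_dominated n : dominated (picard n).
Proof.
elim: n => [t x t0 Dx|n IH t x t0 Dx].
  rewrite mule_ge0 ?lee_fin ?amplification_ge0//.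
  exact: (damped_ge0 kappa BM oD f_ge0).
by rewrite picard_mild//; apply: mild_map_le => //; exact: measurable_picard.
Qed.

Lemma picardE n t x : 0 <= t -> D x ->
  (picard n.+1 (t, x))%:E = mild_map (picard n) (t, x).
Proof. by move=> t0 Dx; apply: picard_mild => //; exact: picard_dominated. Qed.

Let picard_out n p : ~ domain p -> picard n p = 0.
Proof. by case: n => [|n] np //=; rewrite patchE memNset. Qed.

Lemma picardS n p : picard n p <= picard n.+1 p.
Proof.
elim: n p => [p|n IH [t x]]; first exact: picard_ge0.
have [[t0 Dx]|ntx] := pselect (domain (t, x)).
  have := le_mild_map (t, x) (measurable_picard n) (measurable_picard n.+1) IH.
  by rewrite -(picardE n t0 Dx) -(picardE n.+1 t0 Dx) lee_fin.
by rewrite (picard_out n.+1 ntx) (picard_out n.+2 ntx).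
Qed.

Definition picard_limit p : R := limn (fun n => picard n p).

Lemma picard_cvg p : picard n p @[n --> \oo] --> picard_limit p.
Proof.
have nd : nondecreasing_seq (fun n => picard n p).
  by apply/nondecreasing_seqP => n; exact: picardS.
case: p nd => t x nd; apply: nondecreasing_is_cvgn => //.
have [[/= t0 Dx]|ntx] := pselect (domain (t, x)).
  have dfin := damped_fin_num BM oD D0 f_ge0 cf L0 beta0 cw Jlt1 t0 Dx.
  exists (ampl t * fine (damped t x)) => _ [n _ <-].
  by rewrite -lee_fin EFinM fineK// picard_dominated.
by exists 0 => _ [n _ <-]; rewrite picard_out.
Qed.

Lemma measurable_picard_limit : measurable_fun setT picard_limit.
Proof.
apply: (measurable_fun_cvg (h := picard)) => [n|p _]; first exact: measurable_picard.
exact: picard_cvg.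
Qed.

Lemma picard_limit_ge0 p : 0 <= picard_limit p.
Proof.
apply: limr_ge; first by apply/cvg_ex; exists (picard_limit p); exact: picard_cvg.
by apply: nearW => n; exact: picard_ge0.
Qed.

(** The iterates converge to the limit, their images under [mild_map] to the
    image of the limit, and both sequences coincide up to a shift. *)
Lemma picard_limit_fixpoint t x : 0 <= t -> D x ->
  (picard_limit (t, x))%:E = mild_map picard_limit (t, x).
Proof.
move=> t0 Dx.
have c1 : (picard n.+1 (t, x))%:E @[n --> \oo] --> (picard_limit (t, x))%:E.
  apply: cvg_EFin; first exact: nearW.
  by rewrite (cvg_shiftS (fun n => picard n (t, x))); exact: picard_cvg.
have c2 : mild_map (picard n) (t, x) @[n --> \oo] --> mild_map picard_limit (t, x).
  apply: cvg_mild_map.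
  - exact: measurable_picard.
  - exact: picard_ge0.
  - exact: picardS.
  - exact: picard_limit_ge0.
  - exact: picard_cvg.
have e : (fun n => (picard n.+1 (t, x))%:E) = (fun n => mild_map (picard n) (t, x)).
  by apply/funext => n; exact: picardE.
by rewrite e in c1; exact: (cvg_unique _ c1 c2).
Qed.

Lemma picard_limit_le t x : 0 <= t -> D x ->
  ((picard_limit (t, x))%:E <= (ampl t)%:E * damped t x)%E.
Proof.
move=> t0 Dx.
have dfin := damped_fin_num BM oD D0 f_ge0 cf L0 beta0 cw Jlt1 t0 Dx.
rewrite -(fineK dfin) -EFinM lee_fin; apply: limr_le.
  by apply/cvg_ex; exists (picard_limit (t, x)); exact: picard_cvg.
apply: nearW => n; rewrite -lee_fin EFinM fineK//.
exact: picard_dominated.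
Qed.

End picard.

(** * Global solution *)

Theorem theorem5 (R : realType) (d : nat) (D : set 'rV[R]_d)
  (Lambda beta kappa : R) (G : R -> R) (f : 'rV[R]_d -> R)
  (disp : measure_display) (Omega : measurableType disp)
  (P : probability Omega R) (W : R -> Omega -> R)
  (disp' : measure_display) (Omega' : measurableType disp')
  (P' : probability Omega' R) (B : R -> Omega' -> 'rV[R]_d)
  (d_gt0 : (0 < d)%N)
  (D_domain : bounded_smooth_domain D)
  (Lambda_gt0 : 0 < Lambda) (beta_gt0 : 0 < beta) (kappa_neq0 : kappa != 0)
  (G_ge0 : forall z : R, 0 <= z -> 0 <= G z)
  (G_loc_lipschitz : [locally [lipschitz G z | z in `[0, +oo[]])
  (G_0 : G 0 = 0)
  (G_increasing : forall y z : R, 0 < y -> y <= z -> G y / y <= G z / z)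
  (G_le : forall z : R, 0 < z -> G z <= Lambda * z `^ (1 + beta))
  (W_brownian : brownian_motion P W)
  (f_ge0 : forall x, D x -> 0 <= f x)
  (f_C2 : class_C 2 D f)
  (f_neq0 : exists2 x, D x & f x != 0)
  (B_brownian : brownian_motion_rV P' B) :
  let S := killed_semigroup P' B D in
  forall omega : Omega,
  let w := fun t : R => W t omega in
  let J := weighted_integral D S kappa beta w f in
  ((Lambda * beta)%:E * J `[0%R, +oo[%classic < 1)%E ->
  exists2 v : R -> 'rV[R]_d -> R,
    global_mild_solution D S kappa G w f v &
    forall (t : R) x, 0 <= t -> D x ->
      0 <= v t x /\
      ((v t x)%:E <= damped S kappa f t x *
         ((1 - Lambda * beta * fine (J `[0%R, t]%classic)) `^ (beta^-1))^-1%:E)%E.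
Proof.
move=> S omega w J Jlt1.
have [oD _ D0 _ _] := D_domain.
have cf : {in D, continuous f} by case: f_C2.
have cw : {within `[0, +oo[, continuous w} := bm_continuous W_brownian (w := omega).
pose u := picard_limit P' B D kappa f w G.
have u_ge0 p : 0 <= u p.
  exact: (picard_limit_ge0 B_brownian oD D0 f_ge0 cf Lambda_gt0 beta_gt0 cw G_ge0
    G_0 G_increasing G_le Jlt1).
have measurable_u : measurable_fun setT u.
  exact: (measurable_picard_limit B_brownian oD D0 f_ge0 cf Lambda_gt0 beta_gt0 cw
    G_ge0 G_0 G_increasing G_le Jlt1).
exists (fun t x => u (t, x)); last first.
  move=> t x t0 Dx; split; first exact: u_ge0.
  rewrite muleC.
  exact: (picard_limit_le B_brownian oD D0 f_ge0 cf Lambda_gt0 beta_gt0 cw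
    G_ge0 G_0 G_increasing G_le Jlt1).
split.
- by move=> t x _ _; exact: u_ge0.
- apply: measurable_funTS; have := measurable_time_spaceW measurable_u.
  by apply: eq_measurable_fun => -[].
move=> t x t0 Dx.
rewrite (picard_limit_fixpoint B_brownian oD D0 f_ge0 cf Lambda_gt0 beta_gt0 cw
    G_ge0 G_loc_lipschitz G_0 G_increasing G_le Jlt1 t0 Dx).
rewrite /mild_map /= (max_r t0); congr (_ + _)%E.
apply: eq_integral => r; rewrite inE/= in_itv/= => /andP[r0 rt].
have tr0 : 0 <= t - r by rewrite subr_ge0.
rewrite /duhamel/= (max_r tr0) /S killed_semigroupE//; congr (_ * _)%E.
apply: (eq_killed_mean B_brownian oD) => // y Dy /=.
by rewrite sourceE.
Qed.
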